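(* For every $n\ge 3$, the group $\mathrm{SL}_n(\mathbb{Z})$ has Kazhdan's property (T). Moreover, with the generating set $S_n$ of elementary matrices, its Kazhdan radius is at most $2$.
   Context: For $i\ne j$, $E_{ij}\in\mathrm{SL}_n(\mathbb{Z})$ is the matrix differing from the identity only in position $(i,j)$, where its entry is $1$; $S_n=\{E_{ij}^{\pm1}:1\le i\ne j\le n\}$. For a group $G$ with finite symmetric generating set $S$: $*$ is the linear involution of $\mathbb{R}G$ induced by $g\mapsto g^{-1}$; the Laplacian is $\Delta=|S|-\sum_{s\in S}s\in\mathbb{R}G$; $B_R$ is the ball of radius $R$ about $1$ in the word metric of $S$; $\Sigma^2_R\mathbb{R}G$ is the set of finite sums $\sum_i\xi_i^*\xi_i$ with each $\xi_i\in\mathbb{R}G$ supported in $B_R$. $(G,S)$ has Kazhdan radius at most $R$ if $\Delta^2-\lambda\Delta\in\Sigma^2_R\mathbb{R}G$ for some $\lambda>0$. *)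

(* Defs.v *)
From HB Require Import structures.
From mathcomp Require Import all_boot all_order all_algebra.
From Stdlib Require Import Reals.
Set Implicit Arguments. Unset Strict Implicit. Unset Printing Implicit Defensive.

Section Group.
Local Open Scope ring_scope.
Variable n : nat.

Definition SLn (A : 'M[int]_n) : Prop := \det A = 1.
Definition gmul (A B : 'M[int]_n) : 'M[int]_n := A *m B.
Definition gone : 'M[int]_n := 1%:M.
Definition ginv (A : 'M[int]_n) : 'M[int]_n := invmx A.

Definition Elem (i j : 'I_n) : 'M[int]_n := 1%:M + delta_mx i j.

(** S_n = { E_ij^{+-1} : i <> j } (as a duplicate-free list). *)
Definition offdiag : seq ('I_n * 'I_n) :=
  [seq ij <- enum {: 'I_n * 'I_n} | ij.1 != ij.2].
Definition Sgen : seq 'M[int]_n :=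
  [seq Elem ij.1 ij.2 | ij <- offdiag] ++ [seq ginv (Elem ij.1 ij.2) | ij <- offdiag].
End Group.

Section GroupRing.
Variable n : nat.
Notation G := ('M[int]_n).

(** Elements of the real group ring R[G], given as finite formal sums
    sum_k c_k g_k (lists of pairs); two such are equal in R[G] iff they
    have the same coefficient at every group element. *)
Definition RG := seq (G * R).
Definition coef (x : RG) (h : G) : R :=
  foldr Rplus R0 [seq p.2 | p <- x & p.1 == h].
Definition rg_eq (x y : RG) : Prop := forall h, coef x h = coef y h.
Definition rg_add (x y : RG) : RG := x ++ y.
Definition rg_sum (xs : seq RG) : RG := flatten xs.
Definition rg_scale (c : R) (x : RG) : RG := [seq (p.1, Rmult c p.2) | p <- x].
Definition rg_mul (x y : RG) : RG :=
  [seq (gmul p.1 q.1, Rmult p.2 q.2) | p <- x, q <- y].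
Definition rg_star (x : RG) : RG := [seq (ginv p.1, p.2) | p <- x].

(** Laplacian  Delta = |S| - sum_{s in S} s  (S a duplicate-free list). *)
Definition laplacian (S : seq G) : RG :=
  (gone n, INR (size S)) :: [seq (s, Ropp R1) | s <- S].

Definition inBall (S : seq G) (r : nat) (g : G) : Prop :=
  exists w : seq G, (size w <= r)%N /\ (forall s, s \in w -> s \in S) /\
                    g = foldr (@gmul n) (gone n) w.

Definition supported_in_ball (S : seq G) (r : nat) (x : RG) : Prop :=
  forall h, coef x h <> R0 -> inBall S r h.

Definition inSigma2 (S : seq G) (r : nat) (x : RG) : Prop :=
  exists xis : seq RG, (forall xi, List.In xi xis -> supported_in_ball S r xi) /\
    rg_eq x (rg_sum [seq rg_mul (rg_star xi) xi | xi <- xis]).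

Definition KazhdanRadiusLe (S : seq G) (r : nat) : Prop :=
  exists lam : R, Rlt R0 lam /\
    inSigma2 S r (rg_add (rg_mul (laplacian S) (laplacian S))
                         (rg_scale (Ropp lam) (laplacian S))).
End GroupRing.

Record RHilbert := {
  hcar :> Type;
  h0 : hcar;
  hadd : hcar -> hcar -> hcar;
  hopp : hcar -> hcar;
  hscal : R -> hcar -> hcar;
  hinner : hcar -> hcar -> R;
  haddA : forall x y z, hadd x (hadd y z) = hadd (hadd x y) z;
  haddC : forall x y, hadd x y = hadd y x;
  hadd0 : forall x, hadd x h0 = x;
  haddN : forall x, hadd x (hopp x) = h0;
  hscalA : forall a b x, hscal a (hscal b x) = hscal (Rmult a b) x;
  hscal1 : forall x, hscal R1 x = x;
  hscalDv : forall a x y, hscal a (hadd x y) = hadd (hscal a x) (hscal a y);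
  hscalDs : forall a b x, hscal (Rplus a b) x = hadd (hscal a x) (hscal b x);
  hinnerC : forall x y, hinner x y = hinner y x;
  hinnerL : forall a x y z,
      hinner (hadd (hscal a x) y) z = Rplus (Rmult a (hinner x z)) (hinner y z);
  hinner_ge0 : forall x, Rle R0 (hinner x x);
  hinner_eq0 : forall x, hinner x x = R0 -> x = h0;
  hcomplete : forall u : nat -> hcar,
      (forall eps, Rlt R0 eps -> exists N, forall p q, (N <= p)%N -> (N <= q)%N ->
          Rlt (sqrt (hinner (hadd (u p) (hopp (u q))) (hadd (u p) (hopp (u q))))) eps) ->
      exists l, forall eps, Rlt R0 eps -> exists N, forall p, (N <= p)%N ->
          Rlt (sqrt (hinner (hadd (u p) (hopp l)) (hadd (u p) (hopp l)))) eps
}.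

Definition hnorm (H : RHilbert) (x : H) : R := sqrt (hinner x x).
Definition hsub (H : RHilbert) (x y : H) : H := hadd x (hopp y).

Definition orth_rep (n : nat) (H : RHilbert) (pi : 'M[int]_n -> H -> H) : Prop :=
  (forall v, pi (gone n) v = v) /\
  (forall g h, SLn g -> SLn h -> forall v, pi (gmul g h) v = pi g (pi h v)) /\
  (forall g, SLn g -> forall a v w,
      pi g (hadd (hscal a v) w) = hadd (hscal a (pi g v)) (pi g w)) /\
  (forall g, SLn g -> forall v w, hinner (pi g v) (pi g w) = hinner v w).

Definition PropertyT_SL (n : nat) : Prop :=
  exists Q : seq 'M[int]_n, (forall q, q \in Q -> SLn q) /\
  exists eps : R, Rlt R0 eps /\
  forall (H : RHilbert) (pi : 'M[int]_n -> H -> H), orth_rep pi ->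
    (exists v : H, v <> h0 H /\
       forall q, q \in Q -> Rlt (hnorm (hsub (pi q v) v)) (Rmult eps (hnorm v))) ->
    exists w : H, w <> h0 H /\ forall g, SLn g -> pi g w = w.

(* Main.v *)
From Stdlib Require Import Reals ZArith.
Require Import Defs.
From HB Require Import structures.
From mathcomp Require Import all_boot all_order all_algebra ssrZ.
From mathcomp Require Import boolp Rstruct.
From mathcomp Require Import ring lra.
Set Implicit Arguments. Unset Strict Implicit. Unset Printing Implicit Defensive.
Import Order.TTheory GRing.Theory Num.Theory.

(** Write [D_ij = 2 - E_ij - E_ij^-1], so that [Delta_n] is the sum of the [D_ij] over ordered
    pairs [i != j].  Expanding [Delta_n^2] into products [D_ij D_kl] gives [Sq_n + Adj_n + Op_n],
    according to whether [{i,j}] and [{k,l}] are equal, share one vertex, or are disjoint.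
    [Sq_n] is a sum of squares of [D_ij + D_ji], and [Op_n] is one because [E_ij] and [E_kl] then
    commute.  For [Adj_n] one sums over all embeddings of [SL_3] given by triples of distinct
    indices; since the images of [Adj_3] add up to a multiple of [Adj_n] and those of [Delta_3] to
    a multiple of [(n - 2) Delta_n], it is enough that [2 M Adj_3 - Delta_3] is a sum of squares
    supported in the ball of radius 2 for some [M > 0] (Kaluba, Kielak and Nowak).

    For the latter put [T(a,b) = (a - b)^* (a - b) = 2 - a^-1 b - b^-1 a].  Both [2 M Adj_3 - Delta_3]
    and [xi^* xi], for [xi] with vanishing coefficient sum, are combinations of the [T(a,b)], and
    [T(a,b)] only depends on [a^-1 b] up to inversion.  Six explicit integer vectors [xi], together
    with their images under the 48 automorphisms of [SL_3(Z)] that permute the [E_ij^(+-1)], are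
    such that after subtraction of all [xi^* xi] every coefficient of a [T] is nonnegative.

    Property (T) follows by gradient descent: if [Delta^2 >= lambda Delta], then iterating
    [1 - t Delta] on an almost invariant vector makes the energy [<Delta v, v>] decay geometrically,
    hence converges to a nearby vector fixed by every [E_ij], and these generate [SL_n(Z)]. *)

Delimit Scope Z_scope with BZ.

(** * The certificate for [SL_3(Z)] *)

Definition row3 := (Z * Z * Z)%type.
Definition mat3 := (row3 * row3 * row3)%type.
(* [(i, j, true)] and [(i, j, false)] encode [E_ij] and [E_ij^-1]. *)
Definition letter := (nat * nat * bool)%type.
Definition word := seq letter.

Definition one3 : mat3 := ((1, 0, 0), (0, 1, 0), (0, 0, 1))%BZ.

Definition get_row (m : mat3) (i : nat) : row3 :=
  let '(r0, r1, r2) := m in match i with 0 => r0 | 1 => r1 | _ => r2 end.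

Definition add_row (s : bool) (u v : row3) : row3 :=
  let '(a, b, c) := u in let '(a', b', c') := v in
  if s then (a + a', b + b', c + c')%BZ else (a - a', b - b', c - c')%BZ.

(** Left multiplication by [E_ij^(+-1)] is a row operation, so words are evaluated without matrix
    products. *)
Definition lmul3 (l : letter) (m : mat3) : mat3 :=
  let '(i, j, s) := l in
  let r := add_row s (get_row m i) (get_row m j) in
  let '(r0, r1, r2) := m in
  match i with 0 => (r, r1, r2) | 1 => (r0, r, r2) | _ => (r0, r1, r) end.

Definition word3 (w : word) : mat3 := foldr lmul3 one3 w.

Definition winv (w : word) : word := rev [seq (l.1, ~~ l.2) | l <- w].

Definition eqrow (u v : row3) : bool :=
  let '(a, b, c) := u in let '(a', b', c') := v in
  [&& Z.eqb a a', Z.eqb b b' & Z.eqb c c'].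
Definition eqmat (m m' : mat3) : bool :=
  let '(a, b, c) := m in let '(a', b', c') := m' in
  [&& eqrow a a', eqrow b b' & eqrow c c'].

Definition term := (Z * word * word)%type.
Definition entry := (mat3 * mat3 * term)%type.

(** The keys are [a^-1 b] and its inverse in [SL_3(Z)]; keeping both lets terms that agree up to
    inversion be recognised by comparison alone. *)
Definition mk_entry (t : term) : entry :=
  let '(c, a, b) := t in (word3 (winv a ++ b), word3 (winv b ++ a), (c, a, b)).

Inductive trie := Leaf | Node of seq entry & trie & trie.

(* Entries stand for [c T(a,b)], whose value is unchanged when the two keys are swapped. *)
Fixpoint add_bucket (e : entry) (s : seq entry) : seq entry :=
  if s is e' :: s' then
    let '(g, h, (c, a, b)) := e in let '(g', h', (c', a', b')) := e' in
    if eqmat g g' && eqmat h h' || eqmat g h' && eqmat h g' then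
      (g', h', ((c + c')%BZ, a', b')) :: s'
    else e' :: add_bucket e s'
  else [:: e].

Fixpoint add_trie (p : positive) (e : entry) (t : trie) : trie :=
  let '(s, l, r) := if t is Node s l r then (s, l, r) else ([::], Leaf, Leaf) in
  match p with
  | xH => Node (add_bucket e s) l r
  | xO p => Node s (add_trie p e l) r
  | xI p => Node s l (add_trie p e r)
  end.

(* Only the speed of [collect] depends on the hash: colliding keys share a bucket. *)
Definition hash_row (h : Z) (r : row3) : Z :=
  let '(a, b, c) := r in (5 * (5 * (5 * h + a) + b) + c)%BZ.
Definition hash (m : mat3) : Z :=
  let '(a, b, c) := m in hash_row (hash_row (hash_row 0 a) b) c.
Definition hash_entry (e : entry) : positive :=
  let '(g, h, _) := e in Z.to_pos (hash g + hash h + 1000000)%BZ.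

Definition collect (ts : seq term) : trie :=
  foldl (fun t x => let e := mk_entry x in add_trie (hash_entry e) e t) Leaf ts.

Fixpoint all_trie (P : pred entry) (t : trie) : bool :=
  if t is Node s l r then [&& all P s, all_trie P l & all_trie P r] else true.

Definition valid_letter (l : letter) : bool :=
  [&& l.1.1 < 3, l.1.2 < 3 & l.1.1 != l.1.2].
Definition valid_word (w : word) : bool := (size w <= 2) && all valid_letter w.

(** The keys are recomputed from the stored words, so soundness rests on no invariant of
    [collect]. *)
Definition good_entry (e : entry) : bool :=
  let '(g, h, (c, a, b)) := e in
  [&& Z.leb 0 c, valid_word a, valid_word b,
      eqmat g (word3 (winv a ++ b)) & eqmat h (word3 (winv b ++ a))].

(* A permutation of the indices, three signs (the first one normalised to [+]), and whether to
   compose with the inverse transpose. *)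
Definition automorphism := (seq nat * seq bool * bool)%type.
Definition automorphisms : seq automorphism :=
  [seq (ps, t) | ps <- [seq (p, s) |
     p <- [:: [:: 0; 1; 2]; [:: 0; 2; 1]; [:: 1; 0; 2]; [:: 1; 2; 0]; [:: 2; 0; 1]; [:: 2; 1; 0]],
     s <- [seq [:: false; b; c] | b <- [:: false; true], c <- [:: false; true]]],
   t <- [:: false; true]].
(** Conjugation by a diagonal matrix of signs inverts [E_ij] exactly when the signs at [i] and [j]
    differ; the inverse transpose sends [E_ij] to [E_ji^-1]. *)
Definition act_letter (x : automorphism) (l : letter) : letter :=
  let '(p, e, t) := x in let '(i, j, s) := l in
  let s' := s (+) nth false e i (+) nth false e j in
  if t then (nth 0 p j, nth 0 p i, ~~ s') else (nth 0 p i, nth 0 p j, s').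

Definition gens3 : seq (nat * nat) := [:: (0, 1); (0, 2); (1, 0); (1, 2); (2, 0); (2, 1)].
Definition triples3 : seq (nat * nat * nat) :=
  [:: (0, 1, 2); (0, 2, 1); (1, 0, 2); (1, 2, 0); (2, 0, 1); (2, 1, 0)].

(* [D_e D_f + D_f D_e = 4 D_e + 4 D_f - (sum of T(s,t) for s = E_e^(+-1) and t = E_f^(+-1))]. *)
Definition pair_terms (M : Z) (e f : nat * nat) : seq term :=
  [:: ((4 * M)%BZ, [::], [:: (e, true)]); ((4 * M)%BZ, [::], [:: (f, true)]);
      ((- M)%BZ, [:: (e, true)], [:: (f, true)]); ((- M)%BZ, [:: (e, true)], [:: (f, false)]);
      ((- M)%BZ, [:: (e, false)], [:: (f, true)]); ((- M)%BZ, [:: (e, false)], [:: (f, false)])].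
(** The four [f] are the oriented edges sharing exactly one vertex with [{i,j}]. As [pair_terms]
    contains both orders of the product, the triples contribute [2 M Adj_3]; the first line is
    [- Delta_3]. *)
Definition target_terms (M : Z) : seq term :=
  [seq (Zneg xH, [::], [:: (e, true)]) | e <- gens3] ++
  flatten [seq (let '(i, j, k) := t in
     flatten [seq pair_terms M (i, j) f | f <- [:: (i, k); (k, j); (j, k); (k, i)]]) | t <- triples3].

Fixpoint dotZ (u v : seq Z) : Z :=
  match u, v with x :: u', y :: v' => (x * y + dotZ u' v')%BZ | _, _ => Z0 end.

Definition vectors := seq (word * seq Z).
Fixpoint gram_terms (us : vectors) : seq term :=
  if us is (a, q) :: us' then
    [seq (dotZ q v.2, a, v.1) | v <- us'] ++ gram_terms us'
  else [::].

(** The multiplier [M]. It equals [200000^2], so division by [M] turns the integer vectors below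
    into vectors with entries in multiples of [1/200000]. *)
Definition cert_scale : Z := 40000000000%BZ.

(* Found by semidefinite programming (maximising the smallest residual coefficient of a [T]) and
   rounding; column [k] of the integers is the vector [xi_k], listed against the words on which it
   is supported. *)
Definition cert : vectors := [::
([::], [:: 236068; -25782; 25676; -44952; 13419; 20735]%BZ);
([:: (1,0,false); (0,2,false)], [:: 71900; 0; 0; 0; 0; 0]%BZ);
([:: (1,2,false)], [:: -76483; 34526; 0; 0; 0; 0]%BZ);
([:: (0,2,false)], [:: -98734; 11329; 40395; 0; 0; 0]%BZ);
([:: (1,0,false); (1,2,true)], [:: 7219; 10428; -2928; 16398; 0; 0]%BZ);
([:: (2,0,false)], [:: -43846; -9497; -5964; 4506; 13446; 0]%BZ);
([:: (0,1,false); (1,2,false)], [:: 11214; -6558; -1817; 10289; 7685; 12657]%BZ);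
([:: (1,0,false); (0,2,true)], [:: 40236; 13039; 27922; -25357; -33342; -2289]%BZ);
([:: (1,0,false); (2,1,true)], [:: 7088; -16887; 684; -9066; 31623; -13006]%BZ);
([:: (1,2,true); (0,1,false)], [:: -5447; -4040; 982; -24164; -15154; -17730]%BZ);
([:: (0,1,false); (1,2,true)], [:: -11575; 9931; -2347; 4476; 14220; 6115]%BZ);
([:: (0,2,false); (1,0,true)], [:: 12546; -16207; -21681; 5175; -13810; 7255]%BZ);
([:: (1,0,false); (1,2,false)], [:: 61316; -28781; -8755; -363; -2089; 9123]%BZ);
([:: (0,1,true); (0,2,true)], [:: -2678; -1883; 24514; 2596; -3843; 23733]%BZ);
([:: (2,0,true); (2,1,true)], [:: -21947; -3113; -325; 23969; -39052; 16974]%BZ);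
([:: (1,0,true); (2,1,false)], [:: -9965; -812; 5157; 4131; 1492; -3414]%BZ);
([:: (2,1,true); (0,2,false)], [:: 648; 2910; -11405; -5997; -2960; -1946]%BZ);
([:: (1,2,true); (2,0,false)], [:: 24847; 15243; 16124; -5530; -7063; 4162]%BZ);
([:: (1,0,true); (2,1,true)], [:: 5771; 16932; 11752; -3686; 4969; -3625]%BZ);
([:: (0,1,true); (0,2,false)], [:: 15319; -470; -8905; 3478; 10480; -17550]%BZ);
([:: (0,1,true); (2,1,false)], [:: -2450; 1409; -13976; -2269; -5072; -6692]%BZ);
([:: (1,0,false)], [:: -185152; 13898; -26162; 35185; -22334; -5773]%BZ);
([:: (0,2,true); (1,2,true)], [:: -39754; -3714; 5693; -9811; 15453; 25509]%BZ);
([:: (1,2,true); (2,0,true)], [:: -21502; -29486; -9748; 41090; -20624; -259]%BZ);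
([:: (0,2,true)], [:: -5416; 11045; -33173; 29090; -15765; -35598]%BZ);
([:: (2,0,true); (1,2,true)], [:: -5738; 13211; 4346; -31455; 49779; 7955]%BZ);
([:: (1,0,true); (2,0,true)], [:: 26016; 6491; -3452; -16255; -2213; -11614]%BZ);
([:: (0,2,true); (1,2,false)], [:: 10499; -13162; -12607; -1478; 20755; -14722]%BZ)].

Definition orbit_terms (us : vectors) : seq term :=
  let ts := gram_terms us in
  flatten [seq [seq (t.1.1, map (act_letter x) t.1.2, map (act_letter x) t.2) | t <- ts]
          | x <- automorphisms].

(** For vanishing coefficient sums the Gram terms represent [- xi^* xi], so adding [orbit_terms]
    subtracts all the squares from the target. What is checked is that every coefficient of the
    merged remainder is nonnegative. *)
Lemma cert_good : all_trie good_entry (collect (target_terms cert_scale ++ orbit_terms cert)).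
Proof. by vm_cast_no_check (erefl true). Qed.

Bind Scope ring_scope with R.
Local Open Scope ring_scope.

(** * Soundness of collecting terms in a trie *)

Lemma eqmatP (m m' : mat3) : eqmat m m' -> m = m'.
Proof.
case: m => [[[[a b] c] [[d e] f]] [[g h] i]]; case: m' => [[[[? ?] ?] [[? ?] ?]] [[? ?] ?]] /=.
by move=> /and3P[] /and3P[/Z.eqb_eq-> /Z.eqb_eq-> /Z.eqb_eq->] /and3P[/Z.eqb_eq-> /Z.eqb_eq->
  /Z.eqb_eq->] /and3P[/Z.eqb_eq-> /Z.eqb_eq-> /Z.eqb_eq->].
Qed.

Section TrieValue.
Variable F : mat3 -> R.

Definition entry_val (e : entry) : R :=
  IZR e.2.1.1 * (2 * F one3 - F e.1.1 - F e.1.2).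

Fixpoint trie_val (t : trie) : R :=
  if t is Node s l r then \sum_(e <- s) entry_val e + trie_val l + trie_val r else 0.

Lemma add_bucket_val e s :
  \sum_(x <- add_bucket e s) entry_val x = entry_val e + \sum_(x <- s) entry_val x.
Proof.
elim: s => [|e' s IHs] /=; first by rewrite big_seq1 big_nil addr0.
case: e IHs => [[g h] [[c a] b]] IHs; case: e' => [[g' h'] [[c' a'] b']].
case: ifP => [|_]; last by rewrite !big_cons IHs addrCA.
rewrite !big_cons addrA => /orP eqs; congr (_ + _).
by case: eqs => /andP[/eqmatP -> /eqmatP ->];
  rewrite /entry_val /= plus_IZR RplusE; ring.
Qed.

Lemma add_trie_val p e t : trie_val (add_trie p e t) = entry_val e + trie_val t.
Proof.
elim: p t => [p IHp|p IHp|] [|s l r] /=; rewrite ?IHp ?add_bucket_val ?big_seq1 ?big_nil /=; ring.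
Qed.

Lemma collect_val ts :
  trie_val (collect ts) = \sum_(t <- ts) entry_val (mk_entry t).
Proof.
rewrite /collect -[RHS]addr0 -[X in _ = _ + X]/(trie_val Leaf).
elim: ts Leaf => [|t ts IHts] t0 /=; first by rewrite big_nil add0r.
by rewrite IHts add_trie_val big_cons addrCA addrA.
Qed.

End TrieValue.

(** * Elementary matrices and the embeddings of [SL_3] *)

Section ElementaryMatrices.
Variable n : nat.
Implicit Types (i j : 'I_n).

Lemma Elem_inv i j : i != j -> Elem i j *m (1%:M - delta_mx i j) = 1%:M.
Proof.
move=> ij; rewrite /Elem mulmxDl mul1mx mulmxBr mulmx1 mul_delta_mx_0 1?eq_sym//.
by rewrite subr0 subrK.
Qed.

Lemma mulmx1_ginv (A B : 'M[int]_n) : A *m B = 1%:M -> ginv A = B.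
Proof.
move=> AB; have [uA _] := mulmx1_unit AB.
by rewrite /ginv -[RHS](mulKmx uA) AB mulmx1.
Qed.

Lemma ginv_Elem i j : i != j -> ginv (Elem i j) = 1%:M - delta_mx i j.
Proof. by move=> ij; apply: mulmx1_ginv; exact: Elem_inv. Qed.

Lemma mem_Sgen (s : 'M[int]_n) : s \in Sgen n ->
  exists i j, i != j /\ (s = Elem i j \/ s = ginv (Elem i j)).
Proof.
by rewrite mem_cat => /orP[] /mapP[[i j]]; rewrite mem_filter => /andP[/= ij _] ->;
  exists i, j; split=> //; [left|right].
Qed.

Lemma Elem_Sgen i j : i != j -> Elem i j \in Sgen n.
Proof.
move=> ij; rewrite mem_cat; apply/orP; left; apply/mapP; exists (i, j) => //.
by rewrite mem_filter /= ij mem_enum.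
Qed.

Lemma ginv_Elem_Sgen i j : i != j -> ginv (Elem i j) \in Sgen n.
Proof.
move=> ij; rewrite mem_cat; apply/orP; right; apply/mapP; exists (i, j) => //.
by rewrite mem_filter /= ij mem_enum.
Qed.

End ElementaryMatrices.

Section Embedding.
Variables (n : nat) (f : nat -> 'I_n).
Hypothesis f_inj : {in gtn 3 &, injective f}.

Definition letter_mx (l : letter) : 'M[int]_n :=
  if l.2 then Elem (f l.1.1) (f l.1.2) else ginv (Elem (f l.1.1) (f l.1.2)).
Definition word_mx (w : word) : 'M[int]_n :=
  foldr (@gmul n) (gone n) [seq letter_mx l | l <- w].

Lemma valid_letter_neq (l : letter) : valid_letter l -> f l.1.1 != f l.1.2.
Proof. by case/and3P=> l1 l2; apply: contraNneq => /f_inj ->. Qed.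

Lemma word_mx_cat u v : word_mx (u ++ v) = word_mx u *m word_mx v.
Proof.
rewrite /word_mx; elim: u => [|l u IHu] /=; first by rewrite /gone mul1mx.
by rewrite IHu /gmul mulmxA.
Qed.

Lemma letter_mx_Sgen l : valid_letter l -> letter_mx l \in Sgen n.
Proof.
move=> /valid_letter_neq; rewrite /letter_mx.
by case: ifP => _ ?; [apply: Elem_Sgen | apply: ginv_Elem_Sgen].
Qed.

Lemma valid_letter_inv l : valid_letter (l.1, ~~ l.2) = valid_letter l.
Proof. by []. Qed.

Lemma letter_mxK l : valid_letter l -> letter_mx (l.1, ~~ l.2) *m letter_mx l = 1%:M.
Proof.
move=> /valid_letter_neq; rewrite /letter_mx /=; case: l.2 => /= ij.
  by apply: mulmx1C; rewrite ginv_Elem // Elem_inv.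
by rewrite ginv_Elem // Elem_inv.
Qed.

Lemma word_mxK w : all valid_letter w -> word_mx (winv w) *m word_mx w = 1%:M.
Proof.
elim: w => [|l w IHw] /=; first by rewrite /word_mx /= /gone mul1mx.
case/andP=> lP /IHw {}IHw; rewrite /winv map_cons rev_cons -cats1 word_mx_cat.
rewrite -[l :: w]/([:: l] ++ w) word_mx_cat -mulmxA [_ *m (word_mx [:: l] *m _)]mulmxA.
by rewrite /word_mx /= /gmul /gone !mulmx1 letter_mxK // mul1mx.
Qed.

Lemma ginv_word_mx w : all valid_letter w -> ginv (word_mx w) = word_mx (winv w).
Proof. by move=> wP; apply: mulmx1_ginv; apply: mulmx1C; exact: word_mxK. Qed.

Lemma inBall_word_mx w r : all valid_letter w -> (size w <= r)%N ->
  inBall (Sgen n) r (word_mx w).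
Proof.
move=> /allP wP sw; exists [seq letter_mx l | l <- w]; split; first by rewrite size_map.
by split=> // s /mapP[l /wP lP ->]; apply: letter_mx_Sgen.
Qed.

Definition row_entry (r : row3) (k : nat) : Z :=
  let '(a, b, c) := r in match k with 0%N => a | 1%N => b | _ => c end.
Definition mx_of_mat3 (m : mat3) : 'M[int]_3 :=
  \matrix_(i, j) int_of_Z (row_entry (get_row m i) j).
Definition inj_mx : 'M[int]_(n, 3) := \matrix_(x, a) (x == f a)%:R.

Lemma inj_mx_orth : inj_mx^T *m inj_mx = 1%:M.
Proof.
apply/matrixP=> a b; rewrite !mxE (bigD1 (f a)) //= big1 ?addr0 => [|x xa].
  rewrite !mxE eqxx mul1r; congr (nat_of_bool _)%:R.
  by apply/eqP/eqP => [/f_inj/val_inj -> // | -> //]; exact: ltn_ord.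
by rewrite !mxE (negbTE xa) mul0r.
Qed.

Lemma inj_mx_delta (i j : 'I_3) :
  delta_mx (f i) (f j) = inj_mx *m delta_mx i j *m inj_mx^T.
Proof.
rewrite -(mul_delta_mx (0 : 'I_1)) -[delta_mx i j](mul_delta_mx (0 : 'I_1)) mulmxA -mulmxA.
congr (_ *m _).
  rewrite -colE; apply/matrixP=> x y; rewrite !mxE.
  by rewrite (ord1 y) eqxx andbT.
apply: trmx_inj; rewrite trmx_mul trmxK !trmx_delta -colE.
by apply/matrixP=> x y; rewrite !mxE (ord1 y) eqxx andbT.
Qed.

(** With [J] for [inj_mx], this is [m] acting on the coordinates [f 0], [f 1], [f 2] and the
    identity on the others. *)
Definition embed (m : mat3) : 'M[int]_n :=
  1%:M + inj_mx *m (mx_of_mat3 m - 1%:M) *m inj_mx^T.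

Lemma embed1 : embed one3 = 1%:M.
Proof.
rewrite /embed (_ : mx_of_mat3 one3 = 1%:M) ?subrr ?mulmx0 ?mul0mx ?addr0 //.
by apply/matrixP=> -[[|[|[]]]] // ? [[|[|[]]]] // ?; rewrite !mxE.
Qed.

Lemma mx_of_lmul3 (i j : 'I_3) s (m : mat3) :
  mx_of_mat3 (lmul3 (nat_of_ord i, nat_of_ord j, s) m) =
  mx_of_mat3 m + ((-1) ^+ (~~ s) : int) *: (delta_mx i j *m mx_of_mat3 m).
Proof.
(* In rank-one form each entry is a single product, and the 81 choices of indices are settled by
   computation. *)
have -> : delta_mx i j *m mx_of_mat3 m = delta_mx i (0 : 'I_1) *m row j (mx_of_mat3 m).
  by rewrite rowE mulmxA mul_delta_mx.
apply/matrixP=> a b; rewrite !mxE big_ord1 !mxE eqxx andbT.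
case: m => [[[[? ?] ?] [[? ?] ?]] [[? ?] ?]].
case: i j a b => -[|[|[]]] // ? [[|[|[]]]] // ? [[|[|[]]]] // ? [[|[|[]]]] // ?;
  case: s => /=; rewrite ?mul0r ?mulr0 ?addr0 ?mul1r ?expr0 ?expr1 ?mulN1r ?rmorphD ?rmorphN //=.
Qed.

(** As [J^T J = 1], the map [1 + X |-> 1 + J X J^T] is multiplicative. *)
Lemma inj_mx_mul (X Y : 'M[int]_3) :
  (1%:M + inj_mx *m X *m inj_mx^T) *m (1%:M + inj_mx *m Y *m inj_mx^T) =
  1%:M + inj_mx *m (X + Y + X *m Y) *m inj_mx^T.
Proof.
rewrite mulmxDl mul1mx.
have -> : inj_mx *m X *m inj_mx^T *m (1%:M + inj_mx *m Y *m inj_mx^T) =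
    inj_mx *m X *m inj_mx^T + inj_mx *m X *m (inj_mx^T *m inj_mx) *m Y *m inj_mx^T.
  by rewrite mulmxDr mulmx1 !mulmxA.
rewrite inj_mx_orth mulmx1 !mulmxDr !mulmxDl mulmxA -!addrA.
by congr (_ + _); rewrite addrCA.
Qed.

Lemma embed_lmul3 l m : valid_letter l -> embed (lmul3 l m) = letter_mx l *m embed m.
Proof.
move=> lP; have ij := valid_letter_neq lP.
case: l lP ij => [[i j] s] lP ij; have /and3P[i3 j3 _] := lP.
rewrite /= in i3 j3 ij; clear lP.
have -> : letter_mx (i, j, s) = 1%:M + inj_mx *m (((-1) ^+ (~~ s) : int) *:
    delta_mx (Ordinal i3) (Ordinal j3)) *m inj_mx^T.
  rewrite -scalemxAr -scalemxAl -inj_mx_delta /letter_mx /=.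
  by case: s; rewrite ?ginv_Elem //= ?scale1r ?scaleN1r.
rewrite /embed -[lmul3 _ _]/(lmul3 (nat_of_ord (Ordinal i3), nat_of_ord (Ordinal j3), s) m).
rewrite mx_of_lmul3; move: (mx_of_mat3 m) (Ordinal i3) (Ordinal j3) => M a b {i3 j3 ij}.
rewrite inj_mx_mul; congr (_ + _ *m _ *m _).
by rewrite mulmxBr mulmx1 -scalemxAl -[RHS]addrA [RHS]addrC -[RHS]addrA subrK addrAC.
Qed.

(** This transfers the computation to [SL_n(Z)]: words with equal keys in the trie give equal
    elements there. *)
Lemma embed_word3 w : all valid_letter w -> embed (word3 w) = word_mx w.
Proof.
elim: w => [|l w IHw] /=; first by rewrite embed1.
by case/andP=> lP /IHw IH; rewrite embed_lmul3 // IH.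
Qed.

End Embedding.

(** * The group ring and sums of squares *)

Section GroupRingEval.
Variable n : nat.
Notation G := 'M[int]_n.
Implicit Types (x y xi : RG n) (F : G -> R).

(** The linear extension of [F] to the group ring. Indicator functions recover coefficients, so an
    identity valid for all [F] is an equality in the group ring; matrix coefficients of a
    representation will turn it into one about operators. *)
Definition eval F x : R := \sum_(p <- x) p.2 * F p.1.

Lemma coef_eval x h : coef x h = eval (fun g => (g == h)%:R) x.
Proof.
rewrite /coef /eval; elim: x => [|p x IHx] /=; first by rewrite big_nil.
rewrite big_cons; case: ifP => _ /=; rewrite ?mulr1 ?mulr0 ?add0r ?IHx //.
Qed.

Lemma eval_cat F x y : eval F (x ++ y) = eval F x + eval F y.
Proof. exact: big_cat. Qed.

Lemma eval_flatten F (xs : seq (RG n)) : eval F (flatten xs) = \sum_(x <- xs) eval F x.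
Proof.
elim: xs => [|x xs IHx] /=; first by rewrite /eval !big_nil.
by rewrite eval_cat big_cons IHx.
Qed.

Lemma eval_scale F c x : eval F (rg_scale c x) = c * eval F x.
Proof.
rewrite /eval /rg_scale big_map big_distrr /=; apply: eq_bigr => p _.
by rewrite /= RmultE mulrA.
Qed.

Lemma eval_mul F x y : eval F (rg_mul x y) =
  \sum_(p <- x) \sum_(q <- y) p.2 * q.2 * F (p.1 *m q.1).
Proof. by rewrite /eval /rg_mul big_allpairs_dep /=. Qed.

Definition square F xi : R := eval F (rg_mul (rg_star xi) xi).

Lemma squareE F xi : square F xi =
  \sum_(p <- xi) \sum_(q <- xi) p.2 * q.2 * F (ginv p.1 *m q.1).
Proof. by rewrite /square eval_mul /rg_star big_map. Qed.

Lemma square_scale F c xi : square F (rg_scale c xi) = c ^+ 2 * square F xi.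
Proof.
rewrite !squareE /rg_scale big_map big_distrr /=; apply: eq_bigr => p _.
rewrite big_map big_distrr /=; apply: eq_bigr => q _; rewrite !RmultE; ring.
Qed.

(** A group ring element is represented by the map sending [F] to its value at that element, which
    avoids handling formal sums up to equality. The ball condition bears on every listed term, even
    those that cancel. *)
Definition sos (S : seq G) r (X : (G -> R) -> R) : Prop :=
  exists xis : seq (RG n), (forall xi p, xi \in xis -> p \in xi -> inBall S r p.1) /\
    forall F, X F = \sum_(xi <- xis) square F xi.

Variables (S : seq G) (r : nat).

Lemma eq_sos X Y : (forall F, X F = Y F) -> sos S r X -> sos S r Y.
Proof. by move=> XY [xis [P E]]; exists xis; split=> // F; rewrite -XY. Qed.

Lemma sos0 : sos S r (fun=> 0).
Proof. by exists [::]; split=> // F; rewrite big_nil. Qed.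

Lemma sosD X Y : sos S r X -> sos S r Y -> sos S r (fun F => X F + Y F).
Proof.
move=> [xs [xP xE]] [ys [yP yE]]; exists (xs ++ ys); split=> [xi p|F].
  by rewrite mem_cat => /orP[/xP|/yP]; apply.
by rewrite big_cat /= xE yE.
Qed.

Lemma sosZ c X : 0 <= c -> sos S r X -> sos S r (fun F => c * X F).
Proof.
move=> c0 [xs [xP xE]]; exists [seq rg_scale (Num.sqrt c) x | x <- xs]; split=> [xi p|F].
  by move=> /mapP[x /xP xB ->] /mapP[q /xB qB ->].
rewrite xE big_map big_distrr; apply: eq_bigr => x _.
by rewrite square_scale sqr_sqrtr.
Qed.

Lemma sos_sum (I : eqType) (s : seq I) (P : pred I) X :
  (forall i, i \in s -> P i -> sos S r (X i)) -> sos S r (fun F => \sum_(i <- s | P i) X i F).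
Proof.
elim: s => [|i s IHs] Xs.
  by apply: eq_sos sos0 => F; rewrite big_nil.
have {}IHs := IHs (fun j js => Xs j (mem_behead (s := i :: s) js)).
have [Pi|Pi] := boolP (P i); last by apply: eq_sos IHs => F; rewrite big_cons (negbTE Pi).
by apply: eq_sos (sosD (Xs i (mem_head _ _) Pi) IHs) => F; rewrite big_cons Pi.
Qed.

Lemma sos_square xi : (forall p, p \in xi -> inBall S r p.1) -> sos S r (square^~ xi).
Proof.
move=> xP; exists [:: xi]; split=> [x p|F]; last by rewrite big_seq1.
by rewrite inE => /eqP -> /xP.
Qed.

End GroupRingEval.

(** * Soundness of the certificate *)

Section GramTerms.
Variables (n : nat) (f : nat -> 'I_n).
Hypothesis f_inj : {in gtn 3 &, injective f}.
Local Notation wmx := (word_mx f).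
Local Notation ball2 := (sos (Sgen n) 2).
Implicit Types (F : 'M[int]_n -> R) (a b : word).

Definition pair_val F a b : R :=
  2 * F 1%:M - F (wmx (winv a ++ b)) - F (wmx (winv b ++ a)).
Definition term_val F (t : term) : R := IZR t.1.1 * pair_val F t.1.2 t.2.

Lemma valid_winv a : all valid_letter (winv a) = all valid_letter a.
Proof. by rewrite /winv all_rev all_map; apply: eq_all => l; exact: valid_letter_inv. Qed.

Lemma pair_valC F a b : pair_val F a b = pair_val F b a.
Proof. by rewrite /pair_val addrAC. Qed.

Lemma pair_val_diag F a : all valid_letter a -> pair_val F a a = 0.
Proof. by move=> aP; rewrite /pair_val word_mx_cat word_mxK //; ring. Qed.

Lemma entry_val_embed F (t : term) :
  all valid_letter t.1.2 -> all valid_letter t.2 ->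
  entry_val (F \o embed f) (mk_entry t) = term_val F t.
Proof.
case: t => [[c a] b] /= aP bP.
by rewrite /entry_val /term_val /pair_val /= embed1 !embed_word3 // all_cat valid_winv aP bP.
Qed.

Lemma square_pair F a b : all valid_letter a -> all valid_letter b ->
  square F [:: (wmx a, 1); (wmx b, -1)] = pair_val F a b.
Proof.
move=> aP bP; rewrite squareE !big_cons !big_nil /= !ginv_word_mx // !word_mxK //.
rewrite /pair_val !word_mx_cat; ring.
Qed.

(** An entry that passes the test has the value of [c (a - b)^* (a - b)] with [c >= 0] and with [a],
    [b] of length at most 2. *)
Lemma all_trie_sos (t : trie) : all_trie good_entry t ->
  ball2 (fun F => trie_val (F \o embed f) t).
Proof.
elim: t => [|s l IHl r IHr] /=; first by move=> _; exact: sos0.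
case/and3P=> sP lP rP; apply: sosD (IHr rP); apply: sosD (IHl lP).
apply: sos_sum => e /(allP sP) {sP} + _; case: e => [[g h] [[c a] b]] /and5P[c0].
move=> /andP[sa aP] /andP[sb bP] /eqmatP -> /eqmatP ->.
apply: (@eq_sos _ _ _ (fun F => IZR c * square F [:: (wmx a, 1); (wmx b, -1)])) => [F|].
  by rewrite square_pair // [RHS](@entry_val_embed F (c, a, b)).
apply: sosZ; first by apply/RleP/IZR_le/Z.leb_le.
by apply: sos_square => p; rewrite !inE => /orP[] /eqP -> /=; apply: inBall_word_mx.
Qed.

Definition col (us : vectors) (k : nat) : RG n :=
  [seq (wmx u.1, IZR (nth Z0 u.2 k)) | u <- us].

Lemma dotZE r (u v : seq Z) : size u = r -> size v = r ->
  IZR (dotZ u v) = \sum_(k < r) IZR (nth Z0 u k) * IZR (nth Z0 v k).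
Proof.
elim: r u v => [|r IHr] [|x u] [|y v] //=; first by rewrite big_ord0.
by case=> ru [rv]; rewrite big_ord_recl /= plus_IZR mult_IZR (IHr u v).
Qed.

Lemma dotZC u v : dotZ u v = dotZ v u.
Proof. by elim: u v => [|x u IHu] [|y v] //=; rewrite IHu Z.mul_comm. Qed.

Lemma sum_gram_terms F (us : vectors) : all (fun u => all valid_letter u.1) us ->
  \sum_(u <- us) \sum_(v <- us) IZR (dotZ u.2 v.2) * pair_val F u.1 v.1 =
  2 * \sum_(t <- gram_terms us) term_val F t.
Proof.
elim: us => [|u us IHus] /=; first by rewrite !big_nil mulr0.
case/andP=> uP /IHus {}IHus; rewrite big_cons big_cons pair_val_diag // mulr0 add0r.
under [X in _ + X]eq_bigr => v _ do rewrite big_cons.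
rewrite big_split /= IHus; case: u uP {IHus} => a q /= uP.
rewrite big_cat /= big_map mulrDr addrA; congr (_ + _).
rewrite mulr_natl mulr2n; congr (_ + _); apply: eq_bigr => v _ //=.
by rewrite /term_val /= dotZC pair_valC.
Qed.

(** The condition that each [xi_k] lies in the augmentation ideal. *)
Definition zero_sums r (us : vectors) : bool :=
  all (fun k => Z.eqb (foldr Z.add Z0 [seq nth Z0 u.2 k | u <- us]) Z0) (iota 0 r).

Lemma zero_sumsP r us k : zero_sums r us -> (k < r)%N ->
  \sum_(u <- us) IZR (nth Z0 u.2 k) = 0.
Proof.
move=> /allP/(_ k); rewrite mem_iota /= => + kr => /(_ kr) /Z.eqb_eq /(congr1 IZR); apply: etrans.
elim: us => [|u us IHus] /=; first by rewrite big_nil.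
by rewrite big_cons plus_IZR IHus.
Qed.

(* With vanishing coefficient sums, [sum q_u q_v u^-1 v] is [- sum_(u < v) q_u q_v (u - v)^* (u - v)]. *)
Lemma gram_terms_sos r us : zero_sums r us ->
  all (fun u => valid_word u.1 && (size u.2 == r)) us ->
  ball2 (fun F => - \sum_(t <- gram_terms us) term_val F t).
Proof.
move=> us0 usP.
have usV : all (fun u => all valid_letter u.1) us.
  by apply: sub_all usP => u /andP[/andP[]].
apply: (@eq_sos _ _ _ (fun F => \sum_(k <- enum 'I_r) square F (col us k))) => [F|]; last first.
  apply: sos_sum => k _ _; apply: sos_square => p /mapP[u /(allP usP)].
  by move=> /andP[/andP[su uP] _] ->; apply: inBall_word_mx.
rewrite big_enum /=.
have -> : \sum_(k < r) square F (col us k) = \sum_(u <- us) \sum_(v <- us)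
    IZR (dotZ u.2 v.2) * F (wmx (winv u.1 ++ v.1)).
  under eq_bigr => k _ do rewrite squareE big_map.
  rewrite exchange_big; apply: eq_big_seq => u us_u /=.
  under eq_bigr => k _ do rewrite big_map.
  rewrite exchange_big; apply: eq_big_seq => v us_v /=.
  have [/andP[/andP[_ uP] /eqP su] /andP[_ /eqP sv]] := (allP usP u us_u, allP usP v us_v).
  by rewrite (dotZE su sv) big_distrl; apply: eq_bigr => k _; rewrite word_mx_cat ginv_word_mx.
(* The entries of the Gram matrix add up to the sum over [k] of the squared coefficient sums of the
   [xi_k]. *)
have dot0 : \sum_(u <- us) \sum_(v <- us) IZR (dotZ u.2 v.2) = 0.
  transitivity (\sum_(u <- us) \sum_(v <- us) \sum_(k < r)
    IZR (nth Z0 u.2 k) * IZR (nth Z0 v.2 k)).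
    apply: eq_big_seq => u /(allP usP)/andP[_ /eqP su].
    by apply: eq_big_seq => v /(allP usP)/andP[_ /eqP sv]; exact: dotZE.
  rewrite big1 // => u _; rewrite exchange_big big1 // => k _.
  by rewrite -big_distrr /= (zero_sumsP us0) ?mulr0.
have := sum_gram_terms F usV.
have -> : \sum_(u <- us) \sum_(v <- us) IZR (dotZ u.2 v.2) * pair_val F u.1 v.1 =
    2 * F 1%:M * (\sum_(u <- us) \sum_(v <- us) IZR (dotZ u.2 v.2))
    - \sum_(u <- us) \sum_(v <- us) IZR (dotZ u.2 v.2) * F (wmx (winv u.1 ++ v.1))
    - \sum_(u <- us) \sum_(v <- us) IZR (dotZ u.2 v.2) * F (wmx (winv u.1 ++ v.1)).
  rewrite [X in _ - _ - X]exchange_big /= big_distrr /= -!sumrB; apply: eq_bigr => u _.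
  rewrite big_distrr /= -!sumrB; apply: eq_bigr => v _.
  by rewrite /pair_val [dotZ v.2 _]dotZC; ring.
by rewrite dot0 mulr0 sub0r; lra.
Qed.

Definition act_vectors (x : automorphism) (us : vectors) : vectors :=
  [seq (map (act_letter x) u.1, u.2) | u <- us].

Lemma gram_terms_act x us : gram_terms (act_vectors x us) =
  [seq (t.1.1, map (act_letter x) t.1.2, map (act_letter x) t.2) | t <- gram_terms us].
Proof.
elim: us => [|[a q] us IHus] //=.
by rewrite map_cat -IHus -!map_comp.
Qed.

Lemma orbit_termsE us :
  orbit_terms us = flatten [seq gram_terms (act_vectors x us) | x <- automorphisms].
Proof. by congr flatten; apply: eq_map => x; rewrite gram_terms_act. Qed.

Lemma zero_sums_act r x us : zero_sums r (act_vectors x us) = zero_sums r us.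
Proof. by apply: eq_all => k; rewrite -map_comp. Qed.

(** Each automorphism changes only the words and keeps the coefficients, so vanishing sums persist
    and only the new words have to be checked. *)
Lemma orbit_terms_sos r us : zero_sums r us ->
  all (fun x => all (fun u => valid_word (map (act_letter x) u.1) && (size u.2 == r)) us)
    automorphisms ->
  ball2 (fun F => - \sum_(t <- orbit_terms us) term_val F t).
Proof.
move=> us0 usP.
apply: (@eq_sos _ _ _ (fun F =>
  \sum_(x <- automorphisms) - \sum_(t <- gram_terms (act_vectors x us)) term_val F t)) => [F|].
  by rewrite sumrN orbit_termsE; move: automorphisms => s; rewrite big_flatten big_map.
apply: sos_sum => x xA _; apply: (@gram_terms_sos r); rewrite ?zero_sums_act //.
by rewrite all_map; exact: (allP usP x xA).
Qed.

Lemma orbit_terms_valid us t :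
  all (fun x => all (fun u => valid_word (map (act_letter x) u.1)) us) automorphisms ->
  t \in orbit_terms us -> all valid_letter t.1.2 && all valid_letter t.2.
Proof.
rewrite orbit_termsE => usP /flattenP[s /mapP[x xA ->]].
have : all (fun u => valid_word u.1) (act_vectors x us).
  by rewrite all_map; exact: (allP usP x xA).
elim: (act_vectors x us) => [|[a q] vs IHvs] //= /andP[/andP[_ aP] vsP].
rewrite mem_cat => /orP[/mapP[v vs_v ->] /=|/(IHvs vsP)//].
by rewrite aP; have /andP[] := allP vsP v vs_v.
Qed.

Definition valid_data r (us : vectors) (ts : seq term) : bool :=
  [&& zero_sums r us,
      all (fun x => all (fun u => valid_word (map (act_letter x) u.1) && (size u.2 == r)) us)
        automorphisms &
      all (fun t : term => all valid_letter t.1.2 && all valid_letter t.2) ts].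

(** The target is the remainder stored in the trie plus the negated orbit terms, and both are sums
    of squares. *)
Lemma terms_sos r us ts : valid_data r us ts ->
  all_trie good_entry (collect (ts ++ orbit_terms us)) ->
  ball2 (fun F => \sum_(t <- ts) term_val F t).
Proof.
case/and3P=> us0 us_valid ts_valid good.
apply: eq_sos (sosD (all_trie_sos good) (orbit_terms_sos us0 us_valid)) => F.
have us_words : all (fun x => all (fun u => valid_word (map (act_letter x) u.1)) us)
    automorphisms.
  by apply: sub_all us_valid => x; apply: sub_all => u /andP[].
rewrite collect_val big_cat /=.
have valE ss : (forall t, t \in ss -> all valid_letter t.1.2 && all valid_letter t.2) ->
    \sum_(t <- ss) entry_val (F \o embed f) (mk_entry t) = \sum_(t <- ss) term_val F t.
  by move=> ssP; apply: eq_big_seq => t /ssP/andP[? ?]; exact: entry_val_embed.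
rewrite (valE ts (allP ts_valid)) (valE (orbit_terms us)) ?addrK // => t.
exact: orbit_terms_valid.
Qed.

End GramTerms.

Lemma cert_valid : valid_data 6 cert (target_terms cert_scale).
Proof. by vm_compute. Qed.

(** * The Laplacian of [SL_n(Z)] *)

Section Laplacian.
Variable n : nat.
Notation G := 'M[int]_n.
Implicit Types (F : G -> R) (i j k l : 'I_n).

(** The element [D_ij]. *)
Definition edge i j : RG n :=
  [:: (1%:M, 2); (Elem i j, -1); (ginv (Elem i j), -1)].
Definition edge_mul F i j k l : R := eval F (rg_mul (edge i j) (edge k l)).

Lemma eval_mulE F (x y : RG n) :
  eval F (rg_mul x y) = eval (fun g => eval (fun h => F (g *m h)) y) x.
Proof.
rewrite eval_mul; apply: eq_bigr => p _; rewrite /eval big_distrr /=.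
by apply: eq_bigr => q _; rewrite mulrA.
Qed.

Lemma eval_sumF (I : finType) (P : pred I) (X : I -> G -> R) (x : RG n) :
  eval (fun g => \sum_(i | P i) X i g) x = \sum_(i | P i) eval (X i) x.
Proof.
rewrite /eval; under eq_bigr => p _ do rewrite big_distrr /=.
by rewrite exchange_big.
Qed.

Lemma eval_addF X Y (x : RG n) :
  eval (fun g => X g + Y g) x = eval X x + eval Y x.
Proof. by rewrite /eval -big_split; apply: eq_bigr => p _; rewrite mulrDr. Qed.

Lemma sum_enum (P : pred 'I_n) (X : 'I_n -> R) :
  \sum_(i <- enum 'I_n | P i) X i = \sum_(i | P i) X i.
Proof. by rewrite big_enum_cond; apply: eq_bigl. Qed.

Lemma eq_eval F F' (x : RG n) : F =1 F' -> eval F x = eval F' x.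
Proof. by move=> FF'; apply: eq_bigr => p _; rewrite FF'. Qed.

Lemma eval_laplacian F :
  eval F (laplacian (Sgen n)) = \sum_i \sum_(j | i != j) eval F (edge i j).
Proof.
rewrite /eval /laplacian big_cons /= size_cat !size_map addnn INRE.
rewrite big_map big_cat /= !big_map /gone pair_big_dep /=.
have sumE (X : 'I_n * 'I_n -> R) :
    \sum_(e <- offdiag n) X e = \sum_(e | true && (e.1 != e.2)) X e.
  by rewrite /offdiag big_filter big_enum_cond; apply: eq_bigl => e.
have -> : (size (offdiag n)).*2%:R * F 1%:M = \sum_(e <- offdiag n) 2 * F 1%:M.
  by rewrite big_const_seq count_predT iter_addr addr0 -mul2n natrM -mulr_natl; ring.
rewrite -!big_split /= sumE; apply: eq_bigr => e _.
by rewrite !big_cons big_nil /= RoppE -[R1]/(1 : R); ring.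
Qed.

Lemma eval_laplacian_sqr F : eval F (rg_mul (laplacian (Sgen n)) (laplacian (Sgen n))) =
  \sum_i \sum_(j | i != j) \sum_k \sum_(l | k != l) edge_mul F i j k l.
Proof.
rewrite eval_mulE eval_laplacian; apply: eq_bigr => i _; apply: eq_bigr => j _.
rewrite (eq_eval _ (fun g => eval_laplacian (fun h => F (g *m h)))) eval_sumF.
by apply: eq_bigr => k _; rewrite eval_sumF; apply: eq_bigr => l _; rewrite /edge_mul eval_mulE.
Qed.

Definition sum_triples (X : 'I_n -> 'I_n -> 'I_n -> R) : R :=
  \sum_i \sum_(j | i != j) \sum_(k | (k != i) && (k != j)) X i j k.

Definition distinct3 (t : 'I_n * 'I_n * 'I_n) : bool :=
  [&& t.1.1 != t.1.2, t.2 != t.1.1 & t.2 != t.1.2].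

Lemma sum_triplesE X :
  sum_triples X = \sum_(t | distinct3 t) X t.1.1 t.1.2 t.2.
Proof. by rewrite /sum_triples pair_big_dep /= pair_big_dep. Qed.

Lemma sum_triples_perm (h : 'I_n * 'I_n * 'I_n -> 'I_n * 'I_n * 'I_n) X :
  injective h -> (forall t, distinct3 (h t) = distinct3 t) ->
  sum_triples (fun i j k => let t := h (i, j, k) in X t.1.1 t.1.2 t.2) = sum_triples X.
Proof.
move=> h_inj hP; rewrite !sum_triplesE [RHS](reindex_inj h_inj) /=.
by apply: eq_big => [t|[[i j] k] _] //; rewrite hP.
Qed.

Lemma sum_triples_swap23 X : sum_triples (fun i j k => X i k j) = sum_triples X.
Proof.
apply: (@sum_triples_perm (fun t => (t.1.1, t.2, t.1.2))).
  by move=> [[? ?] ?] [[? ?] ?] [-> -> ->].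
by move=> [[i j] k]; rewrite /distinct3 /= (eq_sym k i) (eq_sym k j) (eq_sym j i) andbCA.
Qed.

Lemma sum_triples_rot X : sum_triples (fun i j k => X j k i) = sum_triples X.
Proof.
apply: (@sum_triples_perm (fun t => (t.1.2, t.2, t.1.1))).
  by move=> [[? ?] ?] [[? ?] ?] [-> -> ->].
by move=> [[i j] k]; rewrite /distinct3 /= (eq_sym k i) (eq_sym k j) andbC -andbA.
Qed.

Lemma sum_triplesD X Y :
  sum_triples (fun i j k => X i j k + Y i j k) = sum_triples X + sum_triples Y.
Proof. by rewrite !sum_triplesE big_split. Qed.

Lemma sum_triplesZ c X :
  sum_triples (fun i j k => c * X i j k) = c * sum_triples X.
Proof. by rewrite !sum_triplesE big_distrr. Qed.

Lemma sum_triples_const (X : 'I_n -> 'I_n -> R) :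
  sum_triples (fun i j _ => X i j) = (n - 2)%:R * \sum_i \sum_(j | i != j) X i j.
Proof.
rewrite big_distrr /=; apply: eq_bigr => i _; rewrite big_distrr /=; apply: eq_bigr => j ij.
rewrite sumr_const mulr_natl; congr (_ *+ _).
(* Since [i != j] forces [n >= 2], the truncated [n - 2] is the number of admissible third
   indices. *)
have cC := cardC [set i; j]; rewrite cards2 ij card_ord in cC.
apply: (@addnI 2%N); transitivity (2 + #|[predC [set i; j]]|)%N.
  by congr addn; apply: eq_card => k; rewrite !inE negb_or.
by rewrite cC subnKC // -cC leq_addr.
Qed.

(** The pairs [(k,l)] are sorted by how [{k,l}] meets [{i,j}]: equal, one common vertex in four
    orientations, or disjoint. *)
Lemma sum_offdiag_split i j (g : 'I_n -> 'I_n -> R) : i != j ->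
  \sum_k \sum_(l | k != l) g k l = g i j + g j i +
  \sum_(k | (k != i) && (k != j)) (g i k + g k j + g j k + g k i) +
  \sum_(k | (k != i) && (k != j)) \sum_(l | [&& l != i, l != j & k != l]) g k l.
Proof.
move=> ij; have ji : j != i by rewrite eq_sym.
have -> : \sum_k \sum_(l | k != l) g k l = \sum_(l | i != l) g i l +
    (\sum_(l | j != l) g j l + \sum_(k | (k != i) && (k != j)) \sum_(l | k != l) g k l).
  by rewrite (bigD1 i) //=; congr (_ + _); rewrite (bigD1 j).
have -> : \sum_(l | i != l) g i l = g i j + \sum_(l | (i != l) && (l != j)) g i l.
  by rewrite (bigD1 j).
have -> : \sum_(l | j != l) g j l = g j i + \sum_(l | (j != l) && (l != i)) g j l.
  by rewrite (bigD1 i).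
have -> : \sum_(k | (k != i) && (k != j)) \sum_(l | k != l) g k l =
    \sum_(k | (k != i) && (k != j)) (g k i + g k j +
      \sum_(l | [&& l != i, l != j & k != l]) g k l).
  apply: eq_bigr => k /andP[ki kj].
  rewrite (bigD1 i) //= -addrA; congr (_ + _).
  rewrite (bigD1 j) ?kj 1?eq_sym //=; congr (_ + _).
  by apply: eq_bigl => l; rewrite -andbA andbC -andbA.
have -> : \sum_(l | (i != l) && (l != j)) g i l = \sum_(k | (k != i) && (k != j)) g i k.
  by apply: eq_bigl => l; rewrite eq_sym.
have -> : \sum_(l | (j != l) && (l != i)) g j l = \sum_(k | (k != i) && (k != j)) g j k.
  by apply: eq_bigl => l; rewrite eq_sym andbC.
rewrite !big_split /=; ring.
Qed.

Definition adj F i j k : R :=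
  edge_mul F i j i k + edge_mul F i j k j + edge_mul F i j j k + edge_mul F i j k i.
Definition sq_part F : R :=
  \sum_i \sum_(j | i != j) (edge_mul F i j i j + edge_mul F i j j i).
Definition op_part F : R := \sum_i \sum_(j | i != j)
  \sum_(k | (k != i) && (k != j)) \sum_(l | [&& l != i, l != j & k != l]) edge_mul F i j k l.

Lemma laplacian_sqr_split F : eval F (rg_mul (laplacian (Sgen n)) (laplacian (Sgen n))) =
  sq_part F + sum_triples (adj F) + op_part F.
Proof.
rewrite eval_laplacian_sqr /sq_part /sum_triples /op_part -!big_split /=.
apply: eq_bigr => i _; rewrite -!big_split /=; apply: eq_bigr => j ij.
by rewrite (sum_offdiag_split _ ij).
Qed.

Local Notation ball2 := (sos (Sgen n) 2).

Lemma inBall1 r : inBall (Sgen n) r 1%:M.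
Proof. by exists [::]. Qed.

Lemma inBall_gen r s : s \in Sgen n -> inBall (Sgen n) r.+1 s.
Proof.
move=> sS; exists [:: s]; split=> //; split=> [t|]; first by rewrite inE => /eqP ->.
by rewrite /= /gmul /gone mulmx1.
Qed.

Lemma inBall_gen2 r s t : s \in Sgen n -> t \in Sgen n -> inBall (Sgen n) r.+2 (s *m t).
Proof.
move=> sS tS; exists [:: s; t]; split=> //; split=> [u|].
  by rewrite !inE => /orP[] /eqP ->.
by rewrite /= /gmul /gone mulmx1.
Qed.

Lemma inBall_edge r i j p : i != j -> p \in edge i j -> inBall (Sgen n) r.+1 p.1.
Proof.
move=> ij; rewrite !inE => /or3P[] /eqP -> /=; first exact: inBall1.
  exact/inBall_gen/Elem_Sgen.
exact/inBall_gen/ginv_Elem_Sgen.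
Qed.

Lemma ginv1 : ginv (1%:M : G) = 1%:M.
Proof. by apply: mulmx1_ginv; rewrite mulmx1. Qed.

Lemma ginvK (A B : G) : A *m B = 1%:M -> ginv (ginv A) = A.
Proof. by move=> AB; rewrite (mulmx1_ginv AB); apply: mulmx1_ginv; exact: mulmx1C. Qed.

Lemma Elem_mulV i j : i != j -> Elem i j *m ginv (Elem i j) = 1%:M.
Proof. by move=> ij; rewrite ginv_Elem // Elem_inv. Qed.

Lemma eval_star_edge F i j : i != j -> eval F (rg_star (edge i j)) = eval F (edge i j).
Proof.
move=> ij; rewrite /eval /= !big_cons !big_nil /= ginv1 (ginvK (Elem_mulV ij)); ring.
Qed.

(** The [D_ij] are self-adjoint, and each [(D_ij + D_ji)^2] arises from both orders of the pair,
    hence the factor one half. *)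
Lemma sq_sos : ball2 sq_part.
Proof.
apply: (@eq_sos _ _ _ (fun F => 2^-1 *
    (\sum_(i <- enum 'I_n) \sum_(j <- enum 'I_n | i != j) square F (edge i j ++ edge j i)))).
  move=> F; rewrite sum_enum; under eq_bigr => i _ do rewrite sum_enum.
  have sqE i j : i != j -> square F (edge i j ++ edge j i) =
      (edge_mul F i j i j + edge_mul F i j j i) + (edge_mul F j i j i + edge_mul F j i i j).
    move=> ij; rewrite /square eval_mulE /rg_star map_cat eval_cat.
    rewrite !eval_star_edge // 1?eq_sym //.
    have catE k l : eval (fun g => eval (fun h => F (g *m h)) (edge i j ++ edge j i)) (edge k l) =
        edge_mul F k l i j + edge_mul F k l j i.
      by rewrite /edge_mul !eval_mulE -eval_addF; apply: eq_eval => g; rewrite eval_cat.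
    by rewrite !catE [X in _ + X]addrC.
  under eq_bigr => i _ do under eq_bigr => j ij do rewrite (sqE _ _ ij).
  under eq_bigr => i _ do rewrite big_split.
  rewrite big_split /= -/(sq_part F).
  have -> : \sum_i \sum_(j | i != j) (edge_mul F j i j i + edge_mul F j i i j) = sq_part F.
    rewrite /sq_part (exchange_big_dep xpredT) //=; apply: eq_bigr => i _.
    by apply: eq_bigl => j; rewrite eq_sym.
  by field.
apply: sosZ; first by rewrite invr_ge0 ler0n.
apply: sos_sum => i _ _; apply: sos_sum => j _ ij; apply: sos_square => p.
by rewrite mem_cat => /orP[]; apply: inBall_edge; rewrite // eq_sym.
Qed.

Lemma Elem_comm i j k l : i != l -> j != k ->
  Elem i j *m Elem k l = Elem k l *m Elem i j.
Proof.
move=> il jk; rewrite /Elem !mulmxDl !mulmxDr !mul1mx !mulmx1.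
by rewrite !mul_delta_mx_0 //= 1?eq_sym // !addr0 -!addrA [delta_mx k l + _]addrC.
Qed.

(** Each [D_ij] is [(1 - E_ij)^* (1 - E_ij)]. When [E_ij] and [E_kl] commute, the product of two
    such squares is the square of [(1 - E_ij) (1 - E_kl)]. *)
Lemma edge_mul_square F i j k l : i != j -> k != l -> i != l -> j != k ->
  edge_mul F i j k l = square F [:: (1%:M, 1); (Elem k l, -1); (Elem i j, -1);
    (Elem i j *m Elem k l, 1)].
Proof.
move=> ij kl il jk; have ab := Elem_comm il jk.
have [aA bB] := (Elem_mulV ij, Elem_mulV kl).
rewrite /edge_mul eval_mul squareE /edge.
move: (Elem i j) (Elem k l) (ginv (Elem i j)) (ginv (Elem k l)) ab aA bB => a b A B ab aA bB.
have [Aa Bb] := (mulmx1C aA, mulmx1C bB).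
have commV (x y Y : G) : x *m y = y *m x -> y *m Y = 1%:M -> x *m Y = Y *m x.
  move=> xy yY; have Yy := mulmx1C yY.
  by rewrite -[LHS]mul1mx -Yy -mulmxA [y *m _]mulmxA -xy -mulmxA yY mulmx1.
have aB := commV _ _ _ ab bB; have Ab := commV _ _ _ (esym ab) aA.
have AB := commV _ _ _ (esym Ab) bB.
have inv_ab : ginv (a *m b) = B *m A.
  by apply: mulmx1_ginv; rewrite -mulmxA [b *m _]mulmxA bB mul1mx.
have [ginv_a ginv_b] := (mulmx1_ginv aA, mulmx1_ginv bB).
rewrite !big_cons !big_nil /= ginv1 ginv_a ginv_b inv_ab !mul1mx !mulmx1 Aa Bb.
have -> : A *m (a *m b) = b by rewrite mulmxA Aa mul1mx.
have -> : B *m (a *m b) = a by rewrite ab mulmxA Bb mul1mx.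
have -> : B *m A *m b = A by rewrite -mulmxA -Ab mulmxA Bb mul1mx.
have -> : B *m A *m a = B by rewrite -mulmxA Aa mulmx1.
have -> : B *m A *m (a *m b) = 1%:M by rewrite -mulmxA [A *m _]mulmxA Aa mul1mx Bb.
rewrite -AB -aB; ring.
Qed.

Lemma op_sos : ball2 op_part.
Proof.
apply: (@eq_sos _ _ _ (fun F =>
  \sum_(i <- enum 'I_n) \sum_(j <- enum 'I_n | i != j)
  \sum_(k <- enum 'I_n | (k != i) && (k != j))
  \sum_(l <- enum 'I_n | [&& l != i, l != j & k != l])
    square F [:: (1%:M, 1); (Elem k l, -1); (Elem i j, -1); (Elem i j *m Elem k l, 1)])).
  move=> F; rewrite sum_enum; apply: eq_bigr => i _; rewrite sum_enum; apply: eq_bigr => j ij.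
  rewrite sum_enum; apply: eq_bigr => k /andP[ki kj].
  rewrite sum_enum; apply: eq_bigr => l /and3P[li lj kl].
  by rewrite edge_mul_square // eq_sym.
apply: sos_sum => i _ _; apply: sos_sum => j _ ij; apply: sos_sum => k _ _.
apply: sos_sum => l _ /and3P[_ _ kl]; apply: sos_square => p.
rewrite !inE => /or4P[] /eqP -> /=; first exact: inBall1.
- exact/inBall_gen/Elem_Sgen.
- exact/inBall_gen/Elem_Sgen.
- by apply: inBall_gen2; apply: Elem_Sgen.
Qed.

End Laplacian.

(** * The certified element of [SL_3], summed over triples *)

Section Target.
Variables (n : nat) (f : nat -> 'I_n).
Implicit Types (F : 'M[int]_n -> R) (e : nat * nat).

Lemma word_mx1 l : word_mx f [:: l] = letter_mx f l.
Proof. by rewrite /word_mx /= /gmul /gone mulmx1. Qed.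

Lemma word_mx2 l l' : word_mx f [:: l; l'] = letter_mx f l *m letter_mx f l'.
Proof. by rewrite /word_mx /= /gmul /gone mulmx1. Qed.

Lemma edge_term_val F c e :
  term_val f F (c, [::], [:: (e, true)]) = IZR c * eval F (edge (f e.1) (f e.2)).
Proof.
rewrite /term_val /pair_val /eval !big_cons big_nil /= !word_mx1 /letter_mx /=; ring.
Qed.

Lemma letter_term_val F c l l' : term_val f F (c, [:: l], [:: l']) =
  IZR c * (2 * F 1%:M - F (letter_mx f (l.1, ~~ l.2) *m letter_mx f l')
    - F (letter_mx f (l'.1, ~~ l'.2) *m letter_mx f l)).
Proof. by rewrite /term_val /pair_val /= !word_mx2. Qed.

Lemma pair_terms_val F M e e' :
  \sum_(t <- pair_terms M e e') term_val f F t =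
  IZR M * (edge_mul F (f e.1) (f e.2) (f e'.1) (f e'.2)
         + edge_mul F (f e'.1) (f e'.2) (f e.1) (f e.2)).
Proof.
rewrite !big_cons big_nil !edge_term_val !letter_term_val mult_IZR opp_IZR RmultE RoppE.
rewrite /edge_mul !eval_mul /edge /letter_mx /eval !big_cons !big_nil /= !mul1mx !mulmx1.
have -> : IZR 4 = 4 :> R by rewrite -INRE INR_IZR_INZ.
ring.
Qed.

End Target.

Definition triple_fun n (i j k : 'I_n) (m : nat) : 'I_n :=
  match m with 0%N => i | 1%N => j | _ => k end.

Lemma triple_fun_inj n (i j k : 'I_n) : i != j -> k != i -> k != j ->
  {in gtn 3 &, injective (triple_fun i j k)}.
Proof.
move=> ij ki kj [|[|[|a]]] [|[|[|b]]] //= _ _ E; move: ij ki kj;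
  by rewrite ?E ?eqxx // -?E ?eqxx.
Qed.

Section Kazhdan.
Variable n : nat.
Implicit Types (F : 'M[int]_n -> R).

(** [D_ij D_f + D_f D_ij] over the four neighbours [f] of [ij]: the [T(a,b)] are self-adjoint, so
    the certificate sees products only in this symmetrised form. *)
Definition sym_adj F (i j k : 'I_n) : R :=
  adj F i j k + (edge_mul F i k i j + edge_mul F k j i j + edge_mul F j k i j + edge_mul F k i i j).

Lemma target_terms_val F M (i j k : 'I_n) :
  \sum_(t <- target_terms M) term_val (triple_fun i j k) F t =
  IZR M * (sym_adj F i j k + sym_adj F i k j + sym_adj F j i k
         + sym_adj F j k i + sym_adj F k i j + sym_adj F k j i)
  - (eval F (edge i j) + eval F (edge i k) + eval F (edge j i)
   + eval F (edge j k) + eval F (edge k i) + eval F (edge k j)).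
Proof.
pose f := triple_fun i j k.
have tripleE (x : nat * nat * nat) : \sum_(t <- let '(a, b, c) := x in
      flatten [seq pair_terms M (a, b) e | e <- [:: (a, c); (c, b); (b, c); (c, a)]])
      term_val f F t = IZR M * sym_adj F (f x.1.1) (f x.1.2) (f x.2).
  case: x => [[a b] c]; rewrite big_flatten big_map.
  under eq_bigr do rewrite pair_terms_val.
  rewrite !big_cons big_nil.
  rewrite /sym_adj /adj /=; ring.
transitivity (\sum_(e <- gens3) IZR (-1) * eval F (edge (f e.1) (f e.2)) +
    \sum_(x <- triples3) IZR M * sym_adj F (f x.1.1) (f x.1.2) (f x.2)).
  rewrite /target_terms big_cat big_flatten !big_map /=; congr (_ + _).
    by apply: eq_bigr => e _; exact: edge_term_val.
  by apply: eq_bigr => x _; exact: tripleE.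
rewrite /gens3 /triples3 !big_cons !big_nil /= -[IZR (-1)]/(-1 : R); ring.
Qed.

Lemma sum_triples_rot2 (X : 'I_n -> 'I_n -> 'I_n -> R) :
  sum_triples (fun i j k => X k i j) = sum_triples X.
Proof. by rewrite -(sum_triples_rot (fun i j k => X k i j)). Qed.

Lemma sum_triples_swap12 (X : 'I_n -> 'I_n -> 'I_n -> R) :
  sum_triples (fun i j k => X j i k) = sum_triples X.
Proof. by rewrite -(sum_triples_swap23 X) -(sum_triples_rot (fun i j k => X i k j)). Qed.

Lemma sum_triples_swap13 (X : 'I_n -> 'I_n -> 'I_n -> R) :
  sum_triples (fun i j k => X k j i) = sum_triples X.
Proof. by rewrite -(sum_triples_swap12 X) -(sum_triples_rot (fun i j k => X j i k)). Qed.

Lemma sum_triples_perms (X : 'I_n -> 'I_n -> 'I_n -> R) :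
  sum_triples (fun i j k => X i j k + X i k j + X j i k + X j k i + X k i j + X k j i) =
  6 * sum_triples X.
Proof.
rewrite !sum_triplesD (sum_triples_swap23 X) (sum_triples_swap12 X) (sum_triples_rot X).
rewrite (sum_triples_rot2 X) (sum_triples_swap13 X); ring.
Qed.

(** Renaming the three indices turns every product in reversed order into a term of [adj]. *)
Lemma sum_triples_sym_adj F : sum_triples (sym_adj F) = 2 * sum_triples (adj F).
Proof.
rewrite /sym_adj /adj !sum_triplesD.
rewrite (sum_triples_swap23 (fun i j k => edge_mul F i j i k)).
rewrite (sum_triples_swap13 (fun i j k => edge_mul F i j k j)).
rewrite (sum_triples_rot (fun i j k => edge_mul F i j k i)).
rewrite (sum_triples_rot2 (fun i j k => edge_mul F i j j k)); ring.
Qed.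

(** Each triple is met once for each of its 6 orderings, symmetrisation doubles [Adj_n], and each
    ordered pair extends to [n - 2] triples. *)
Lemma sum_target_terms F M :
  sum_triples (fun i j k => \sum_(t <- target_terms M) term_val (triple_fun i j k) F t) =
  12 * IZR M * sum_triples (adj F) - 6 * (n - 2)%:R * eval F (laplacian (Sgen n)).
Proof.
pose d i j (_ : 'I_n) := eval F (edge i j).
transitivity (IZR M * (6 * sum_triples (sym_adj F)) - 6 * sum_triples d).
  rewrite -!sum_triples_perms -sum_triplesZ -mulN1r -sum_triplesZ -sum_triplesD !sum_triplesE.
  by apply: eq_bigr => t _; rewrite target_terms_val mulN1r.
rewrite sum_triples_sym_adj (sum_triples_const (fun i j => eval F (edge i j))) eval_laplacian.
ring.
Qed.

Hypothesis n3 : (3 <= n)%N.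

(** The ratio of the two coefficients [6 (n - 2)] and [12 M] in [sum_target_terms]. *)
Definition spectral_gap : R := (n - 2)%:R / (2 * IZR cert_scale).

Lemma spectral_gap_gt0 : 0 < spectral_gap.
Proof.
rewrite /spectral_gap divr_gt0 ?ltr0n ?subn_gt0 // mulr_gt0 ?ltr0n //.
by apply/RltP/IZR_lt.
Qed.

Theorem laplacian_sos : sos (Sgen n) 2 (fun F =>
  eval F (rg_mul (laplacian (Sgen n)) (laplacian (Sgen n)))
  - spectral_gap * eval F (laplacian (Sgen n))).
Proof.
have scale0 : 0 < IZR cert_scale by apply/RltP/IZR_lt.
have triples_sos : sos (Sgen n) 2 (fun F => sum_triples (fun i j k =>
    \sum_(t <- target_terms cert_scale) term_val (triple_fun i j k) F t)).
  apply: (@eq_sos _ _ _ (fun F => \sum_(t <- enum {: 'I_n * 'I_n * 'I_n} | distinct3 t)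
      \sum_(x <- target_terms cert_scale) term_val (triple_fun t.1.1 t.1.2 t.2) F x)) => [F|].
    by rewrite sum_triplesE big_enum_cond; apply: eq_bigl.
  apply: sos_sum => -[[i j] k] _ /and3P[/= ij ki kj].
  exact: (terms_sos (triple_fun_inj ij ki kj) cert_valid cert_good).
have c_ge0 : 0 <= (12 * IZR cert_scale)^-1 by rewrite invr_ge0 mulr_ge0 // ?ler0n // ltW.
apply: eq_sos (sosD (sosD (sq_sos n) (op_sos n)) (sosZ c_ge0 triples_sos)) => F.
rewrite sum_target_terms laplacian_sqr_split /spectral_gap.
move: (IZR cert_scale) scale0 => c c0; field; exact: lt0r_neq0.
Qed.

Lemma In_mem (T : eqType) (x : T) (s : seq T) : List.In x s -> x \in s.
Proof.
by elim: s => //= y s IHs [->|/IHs xs]; rewrite inE ?eqxx ?xs ?orbT.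
Qed.

Lemma sos_supported r (xi : RG n) : (forall p, p \in xi -> inBall (Sgen n) r p.1) ->
  supported_in_ball (Sgen n) r xi.
Proof.
move=> xiP h; rewrite coef_eval => xi_h; apply: contrapT => hP; apply: xi_h.
rewrite /eval big_seq big1 // => p /xiP pP.
by case: eqP => [ph|_]; rewrite ?mulr0 //; case: hP; rewrite -ph.
Qed.

Theorem kazhdan_radius : KazhdanRadiusLe (Sgen n) 2.
Proof.
exists spectral_gap; split; first exact/RltP/spectral_gap_gt0.
have [xis [xisP xisE]] := laplacian_sos; exists xis; split=> [xi /In_mem xi_in|h].
  by apply: sos_supported => p; exact: xisP.
rewrite !coef_eval /rg_add eval_cat eval_scale RoppE mulNr xisE.
by rewrite /rg_sum eval_flatten big_map.
Qed.

End Kazhdan.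

(** * Generation of [SL_n(Z)] by elementary matrices *)

Section Generation.
Variable n : nat.
Implicit Types (A : 'M[int]_n) (i j k r c : 'I_n).

Definition transvection i j (z : int) : 'M[int]_n := 1%:M + z *: delta_mx i j.

Lemma mul_transvectionE A i j z r c :
  (A *m transvection i j z) r c = A r c + (c == j)%:R * (z * A r i).
Proof.
rewrite mulmxDr mulmx1 -scalemxAr !mxE (bigD1 i) //= big1 => [|x xi].
  by rewrite !mxE eqxx addr0; case: eqP => _; rewrite /=; ring.
by rewrite !mxE (negbTE xi) mulr0.
Qed.

Lemma transvectionD i j y z : i != j ->
  transvection i j (y + z) = transvection i j y *m transvection i j z.
Proof.
move=> ij; apply/matrixP=> r c; rewrite mul_transvectionE !mxE (negbTE ij).
by rewrite andbF mulr0 addr0; case: (r == i); case: (c == j) => /=; ring.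
Qed.

Lemma det_transvection i j z : i != j -> \det (transvection i j z) = 1.
Proof.
have low (a b : 'I_n) : (b < a)%N -> \det (transvection a b z) = 1.
  move=> ba; rewrite det_trig ?big1 // => [c _|].
    by rewrite !mxE eqxx; case: eqP => [->|]; rewrite ?mulr0 ?addr0 //= -val_eqE gtn_eqF // mulr0.
  apply/is_trig_mxP => r c rc; rewrite !mxE -val_eqE ltn_eqF //.
  case: eqP => [ra|]; rewrite ?mulr0 ?addr0 //=.
  by rewrite -val_eqE gtn_eqF ?mulr0 // (ltn_trans ba) // -ra.
rewrite -val_eqE neq_ltn => /orP[ij|/low //].
by rewrite -det_tr /transvection linearD linearZ /= trmx1 trmx_delta; exact: low.
Qed.

Lemma transvection1 i j : transvection i j 1 = Elem i j.
Proof. by rewrite /transvection scale1r. Qed.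

Lemma transvectionN1 i j : i != j -> transvection i j (-1) = ginv (Elem i j).
Proof. by move=> ij; rewrite /transvection scaleN1r ginv_Elem. Qed.

Variable P : 'M[int]_n -> Prop.
Hypothesis P1 : P 1%:M.
Hypothesis P_Elem : forall A i j, i != j -> P (A *m Elem i j) -> P A.
Hypothesis P_ginv : forall A i j, i != j -> P (A *m ginv (Elem i j)) -> P A.

(** Transvections are additive in [z], so this is an induction on the integer [z] in both
    directions. *)
Lemma P_transvection A i j z : i != j -> P (A *m transvection i j z) -> P A.
Proof.
move=> ij; elim/int_rect: z A => [|m IHm|m IHm] A.
- by rewrite /transvection scale0r addr0 mulmx1.
- rewrite -[m.+1%:Z]/(1 + m%:Z) transvectionD // mulmxA => /IHm.
  by rewrite transvection1; exact: P_Elem.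
- rewrite -[m.+1%:Z]/(1 + m%:Z) opprD transvectionD // mulmxA => /IHm.
  by rewrite transvectionN1 //; exact: P_ginv.
Qed.

Definition id_rows (k : nat) A := forall r c, (r < k)%N -> A r c = (r == c)%:R.

(** The source column [i] vanishes in the first [k] rows because [k <= i]. *)
Lemma id_rows_transvection k A i j z : id_rows k A -> (k <= i)%N ->
  id_rows k (A *m transvection i j z).
Proof.
move=> Ak ki r c rk; have ri : (r == i) = false.
  by rewrite -val_eqE; exact: ltn_eqF (leq_trans rk ki).
rewrite mul_transvectionE !Ak // ri /=; ring.
Qed.

Section Row.
Variable k : 'I_n.
Hypothesis next : forall A, id_rows k.+1 A -> \det A = 1 -> P A.

(** With pivot 1, multiples of column [k] clear the rest of row [k], on both sides of the diagonal;
    the induction is on the number of entries still to be cleared. *)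
Lemma clear_row A : id_rows k A -> \det A = 1 -> A k k = 1 -> P A.
Proof.
move: {2}#|_| (leqnn #|[set c | (c != k) && (A k c != 0)]|) => m.
elim: m A => [|m IHm] A card_le Ak dA Akk.
  apply: next => // r c; rewrite ltnS leq_eqVlt => /orP[/eqP/val_inj ->|/Ak //].
  have [<-//|kc] := eqVneq; apply/eqP; apply: contraLR card_le => Akc.
  by rewrite -ltnNge card_gt0; apply/set0Pn; exists c; rewrite inE eq_sym kc.
have [A0|[c]] := set_0Vmem [set c | (c != k) && (A k c != 0)].
  by apply: IHm => //; rewrite A0 cards0.
rewrite inE => /andP[ck Akc]; have kc : k != c by rewrite eq_sym.
apply: (@P_transvection _ k c (- A k c) kc); apply: IHm.
- rewrite -ltnS; apply: leq_trans card_le; apply: proper_card.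
  apply/properP; split; last first.
    exists c; rewrite !inE ?ck // mul_transvectionE eqxx Akk mulr1 mul1r subrr.
    by rewrite eqxx andbF.
  apply/subsetP => x; rewrite !inE mul_transvectionE => /andP[-> /=].
  by have [->|_] := eqVneq x c; rewrite ?Akc //= mul0r addr0.
- exact: id_rows_transvection.
- by rewrite det_mulmx dA det_transvection // mulr1.
- by rewrite mul_transvectionE (negbTE kc) mul0r addr0.
Qed.

Lemma unit_row A i : id_rows k A -> \det A = 1 -> (k.+1 < n)%N -> (k <= i)%N ->
  A k i \is a GRing.unit -> P A.
Proof.
move=> Ak dA kn ki Aki.
have detM B a b z : a != b -> \det B = 1 -> \det (B *m transvection a b z) = 1.
  by move=> ab dB; rewrite det_mulmx dB det_transvection // mulr1.
have sqr1 : A k i * A k i = 1.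
  by move: (Aki : (A k i == 1) || (A k i == -1)) => /orP[] /eqP ->.
have [ik|ik] := eqVneq i k; last first.
  (* As [A k i] is its own inverse, adding this multiple of column [i] makes the pivot 1. *)
  apply: (@P_transvection _ i k (A k i * (1 - A k k)) ik).
  apply: clear_row; [exact: id_rows_transvection|exact: detM|].
  rewrite mul_transvectionE eqxx mul1r mulrAC sqr1 /=; ring.
move: sqr1 => {Aki ki}; rewrite {}ik => sqr1.
(* The unit is the pivot itself and may be -1: it is used to put 1 into the next column, from which
   the pivot is then corrected to 1. *)
pose j : 'I_n := Ordinal kn; have kj : k != j by rewrite -val_eqE /= ltn_eqF.
have jk : j != k by rewrite eq_sym.
apply: (@P_transvection _ k j ((1 - A k j) * A k k) kj).
apply: (@P_transvection _ j k (1 - A k k) jk).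
have Aj : (A *m transvection k j ((1 - A k j) * A k k)) k j = 1.
  by rewrite mul_transvectionE eqxx -mulrA sqr1 /=; ring.
apply: clear_row.
- by apply: id_rows_transvection; [exact: id_rows_transvection|exact: leqnSn].
- by apply: (detM _ _ _ _ jk); exact: detM.
- rewrite mul_transvectionE Aj eqxx mul_transvectionE (negbTE kj) /=; ring.
Qed.

(** Column [k] of the inverse gives a Bezout relation for row [k]. Its entries above position [k]
    vanish because the rows of [A] above are those of the identity. *)
Lemma row_nonzero A : id_rows k A -> \det A = 1 ->
  exists B : 'I_n -> int, \sum_(c < n | (k <= c)%N) A k c * B c = 1.
Proof.
move=> Ak dA; have uA : A \in unitmx by rewrite unitmxE dA unitr1.
exists (fun c => invmx A c k).
have <- : (A *m invmx A) k k = 1 by rewrite mulmxV // mxE eqxx.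
rewrite mxE.
rewrite [RHS](bigID (fun c : 'I_n => (k <= c)%N)) /= [X in _ + X]big1 ?addr0 // => c.
rewrite -ltnNge => ck.
have : (A *m invmx A) c k = 0 by rewrite mulmxV // mxE -val_eqE ltn_eqF.
rewrite mxE (bigD1 c) //= Ak // eqxx mul1r big1 ?addr0 => [->|x xc]; first by rewrite mulr0.
by rewrite Ak // eq_sym (negbTE xc) mul0r.
Qed.

(** Euclid's algorithm on the entries of row [k] from the diagonal on, by induction on the sum of
    their absolute values. When no division is possible a single nonzero entry remains, and the
    Bezout relation makes it a unit. *)
Lemma euclid_row A : id_rows k A -> \det A = 1 -> P A.
Proof.
move: {2}(\sum_(c < n | (k <= c)%N) `|A k c|)%N
  (leqnn (\sum_(c < n | (k <= c)%N) `|A k c|)%N) => m.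
elim: m A => [|m IHm] A sum_le Ak dA; have [B AB] := row_nonzero Ak dA.
  suff : (1 : int) = 0 by [].
  rewrite -AB big1 // => c kc; move: sum_le; rewrite leqn0 sum_nat_eq0.
  by move=> /forallP/(_ c); rewrite kc /= absz_eq0 => /eqP ->; rewrite mul0r.
have [/existsP[i /existsP[j /and5P[ki kj ij Ai0 Aij]]]|none] := boolP [exists i : 'I_n, exists j : 'I_n,
    [&& (k <= i)%N, (k <= j)%N, i != j, A k i != 0 & (`|A k i| <= `|A k j|)%N]].
  apply: (@P_transvection _ i j (- (A k j %/ A k i)%Z) ij); apply: IHm.
  - rewrite -ltnS; apply: leq_trans sum_le.
    rewrite (bigD1 j) //= [ltnRHS](bigD1 j) //= mul_transvectionE eqxx.
    rewrite (eq_bigr (fun c => `|A k c|%N)) => [|c /andP[_ cj]]; last first.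
      by rewrite mul_transvectionE (negbTE cj) mul0r addr0.
    rewrite ltn_add2r mul1r mulNr; apply: leq_trans Aij.
    have -> : A k j - (A k j %/ A k i)%Z * A k i = (A k j %% A k i)%Z by [].
    by rewrite -ltz_nat !abszE (ger0_norm (modz_ge0 _ Ai0)) ltz_mod.
  - exact: id_rows_transvection.
  - by rewrite det_mulmx dA det_transvection // mulr1.
have [i ki Ai0] : exists2 i : 'I_n, (k <= i)%N & A k i != 0.
  apply/exists_inP; apply: contraT => /exists_inPn A0; suff : (1 : int) = 0 by [].
  by rewrite -AB big1 // => c /A0; rewrite negbK => /eqP ->; rewrite mul0r.
have other j : (k <= j)%N -> j != i -> A k j = 0.
  move=> kj ji; apply/eqP; apply: contraNT none => Aj0.
  have [le|/ltnW le] := leqP `|A k i| `|A k j|.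
    by apply/existsP; exists i; apply/existsP; exists j; rewrite ki kj eq_sym ji Ai0.
  by apply/existsP; exists j; apply/existsP; exists i; rewrite ki kj ji Aj0.
have Aiu : A k i \is a GRing.unit.
  have : A k i * B i = 1.
    rewrite -AB (bigD1 i) //= big1 ?addr0 // => c /andP[kc ci].
    by rewrite other // mul0r.
  by move=> Ai; apply/unitrP; exists (B i); rewrite mulrC.
have [kn|nk] := ltnP k.+1 n; first exact: (unit_row Ak dA kn ki Aiu).
(* In the last row no spare column is left, but [A] is then lower triangular and its determinant
   equals the pivot. *)
apply: clear_row => //.
have last_k c : (c <= k)%N by rewrite -ltnS (leq_trans (ltn_ord c)).
rewrite -dA det_trig; last first.
  apply/is_trig_mxP => r c rc; have rk : (r < k)%N by apply: leq_trans rc (last_k c).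
  by rewrite Ak // -val_eqE ltn_eqF.
rewrite (bigD1 k) //= big1 ?mulr1 // => c ck; rewrite Ak ?eqxx //.
by rewrite ltn_neqAle last_k andbT.
Qed.

End Row.
(** Column operations reduce [A] to the identity row by row, and [P] is carried back along them. *)
Lemma SL_ind A : \det A = 1 -> P A.
Proof.
suff id_ind m (k : nat) B : (k + m = n)%N -> id_rows k B -> \det B = 1 -> P B.
  by move=> dA; apply: (id_ind n 0%N).
elim: m k B => [|m IHm] k B.
  rewrite addn0 => kn Bk _; suff -> : B = 1%:M by [].
  by apply/matrixP=> r c; rewrite Bk ?kn // mxE.
move=> kmn; have kn : (k < n)%N by rewrite -kmn addnS ltnS leq_addr.
apply: (@euclid_row (Ordinal kn)) => C Ck dC; apply: (IHm k.+1) => //.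
by rewrite addSnnS.
Qed.

End Generation.

(** * Property (T) *)

Section HilbertModule.
Variable H : RHilbert.

HB.instance Definition _ := gen_eqMixin (hcar H).
HB.instance Definition _ := gen_choiceMixin (hcar H).

Lemma hadd0l : left_id (h0 H) (@hadd H).
Proof. by move=> x; rewrite haddC hadd0. Qed.
Lemma haddNl : left_inverse (h0 H) (@hopp H) (@hadd H).
Proof. by move=> x; rewrite haddC haddN. Qed.

HB.instance Definition _ :=
  GRing.isZmodule.Build (hcar H) (@haddA H) (@haddC H) hadd0l haddNl.

Lemma hscalDsE (v : H) (a b : R) : hscal (a + b) v = hscal a v + hscal b v.
Proof. exact: hscalDs. Qed.

HB.instance Definition _ := GRing.Zmodule_isLmodule.Build R (hcar H)
  (@hscalA H) (@hscal1 H) (@hscalDv H) hscalDsE.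

Implicit Types (x y z : hcar H) (a b : R).

Definition inner x y : R := hinner x y.
Definition norm x : R := Num.sqrt (inner x x).

Lemma innerC x y : inner x y = inner y x. Proof. exact: hinnerC. Qed.
Lemma innerDl x y z : inner (x + y) z = inner x z + inner y z.
Proof. by have := hinnerL 1 x y z; rewrite hscal1 RmultE mul1r. Qed.
Lemma inner0l x : inner 0 x = 0.
Proof. by apply: (addrI (inner 0 x)); rewrite -innerDl !addr0. Qed.
Lemma innerZl a x y : inner (a *: x) y = a * inner x y.
Proof.
have := hinnerL a x 0 y; rewrite -[hadd _ _]/(a *: x + 0) -![hinner _ _]/(inner _ _).
by rewrite inner0l addr0 RplusE addr0.
Qed.
Lemma innerNl x y : inner (- x) y = - inner x y.
Proof. by rewrite -scaleN1r innerZl mulN1r. Qed.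
Lemma innerDr x y z : inner x (y + z) = inner x y + inner x z.
Proof. by rewrite innerC innerDl ![inner _ x]innerC. Qed.
Lemma innerZr a x y : inner x (a *: y) = a * inner x y.
Proof. by rewrite innerC innerZl innerC. Qed.
Lemma innerNr x y : inner x (- y) = - inner x y.
Proof. by rewrite innerC innerNl innerC. Qed.
Lemma inner_suml (I : Type) (s : seq I) (X : I -> H) y :
  inner (\sum_(i <- s) X i) y = \sum_(i <- s) inner (X i) y.
Proof. by elim: s => [|i s IHs]; rewrite ?big_nil ?inner0l // !big_cons innerDl IHs. Qed.
Lemma inner_sumr (I : Type) (s : seq I) (X : I -> H) y :
  inner y (\sum_(i <- s) X i) = \sum_(i <- s) inner y (X i).
Proof. by rewrite innerC inner_suml; apply: eq_bigr => i _; rewrite innerC. Qed.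

Lemma inner_ge0 x : 0 <= inner x x. Proof. by apply/RleP; exact: hinner_ge0. Qed.
Lemma inner_eq0 x : inner x x = 0 -> x = 0. Proof. exact: hinner_eq0. Qed.

Lemma norm_ge0 x : 0 <= norm x. Proof. exact: sqrtr_ge0. Qed.
Lemma sqr_norm x : norm x ^+ 2 = inner x x. Proof. exact/sqr_sqrtr/inner_ge0. Qed.
Lemma normN x : norm (- x) = norm x. Proof. by rewrite /norm innerNl innerNr opprK. Qed.
Lemma norm_gt0 x : x <> 0 -> 0 < norm x.
Proof.
move=> x0; rewrite lt_neqAle norm_ge0 andbT eq_sym; apply/eqP => nx.
by apply: x0; apply: inner_eq0; rewrite -sqr_norm nx expr0n.
Qed.
Lemma norm_le x c : 0 <= c -> inner x x <= c ^+ 2 -> norm x <= c.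
Proof. by move=> c0; rewrite -sqr_norm ler_sqr ?nnegrE ?norm_ge0. Qed.

Lemma cauchy_schwarz x y : inner x y <= norm x * norm y.
Proof.
have [y0|/eqP/norm_gt0 ny] := eqVneq y 0.
  by rewrite y0 innerC inner0l mulr_ge0 ?norm_ge0.
have [xy_le0|xy_gt0] := leP (inner x y) 0.
  by rewrite (le_trans xy_le0) // mulr_ge0 ?norm_ge0.
rewrite -ler_sqr ?nnegrE ?(ltW xy_gt0) ?mulr_ge0 ?norm_ge0 // exprMn !sqr_norm.
have yy : 0 < inner y y by rewrite -sqr_norm exprn_gt0.
(* This square expands to [inner y y] times the difference of the two sides of the squared
   inequality. *)
have := inner_ge0 (inner y y *: x - inner x y *: y).
rewrite innerDl !innerDr !innerNl !innerNr !innerZl !innerZr (innerC y x).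
move=> h; rewrite -subr_ge0 -(pmulr_rge0 _ yy); apply: le_trans h _.
by rewrite le_eqVlt; apply/orP; left; apply/eqP; ring.
Qed.

Lemma normD x y : norm (x + y) <= norm x + norm y.
Proof.
apply: norm_le; first by rewrite addr_ge0 ?norm_ge0.
rewrite innerDl !innerDr sqrrD !sqr_norm (innerC y x).
have := cauchy_schwarz x y; lra.
Qed.

Lemma hnormE x : hnorm x = norm x. Proof. by rewrite /hnorm RsqrtE. Qed.

Lemma norm_complete (u : nat -> H) :
  (forall eps, 0 < eps -> exists N, forall p q,
    (N <= p)%N -> (N <= q)%N -> norm (u p - u q) < eps) ->
  exists l, forall eps, 0 < eps -> exists N, forall p, (N <= p)%N -> norm (u p - l) < eps.
Proof.
move=> cauchy; have [eps /RltP/cauchy [N Nu]|l lP] := @hcomplete H u.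
  by exists N => p q Np Nq; apply/RltP; rewrite -/(hnorm _) hnormE; exact: Nu.
exists l => eps /RltP/lP [N Nl]; exists N => p Np.
by rewrite -hnormE; apply/RltP; exact: Nl.
Qed.

End HilbertModule.

(** * Sequences with geometrically decreasing steps *)

Lemma geometric_lt (a eps : R) : 0 <= a < 1 -> 0 < eps ->
  exists N, forall p, (N <= p)%N -> a ^+ p < eps.
Proof.
move=> /andP[a0 a1] eps0.
have [||N NP] := @pow_lt_1_zero a _ eps; [|exact/RltP|].
  by apply/RltP; rewrite RabsE ger0_norm.
exists N => p Np; have := NP p (elimT ssrnat.leP Np).
by rewrite RpowE RabsE ger0_norm ?exprn_ge0 // => /RltP.
Qed.

Section Descent.
Variables (H : RHilbert) (c a : R) (u : nat -> H).
Hypothesis a01 : 0 <= a < 1.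
Hypothesis step : forall p, norm (u p.+1 - u p) <= c * a ^+ p.

Let c_ge0 : 0 <= c.
Proof. by have := step 0; rewrite expr0 mulr1; apply: le_trans; exact: norm_ge0. Qed.

Lemma tail_bound p m : norm (u (p + m)%N - u p) <= c * a ^+ p / (1 - a).
Proof.
case/andP: a01 => a0 a1; have a1' : 0 < 1 - a by rewrite subr_gt0.
(* The factor [1 - a ^+ m] of the finite geometric sum makes the bound inductive. *)
suff h : norm (u (p + m)%N - u p) <= c * a ^+ p / (1 - a) * (1 - a ^+ m).
  apply: le_trans h _; rewrite ler_piMr ?gerBl ?exprn_ge0 //.
  by rewrite mulr_ge0 ?invr_ge0 ?(ltW a1') // mulr_ge0 ?exprn_ge0.
elim: m => [|m IHm]; first by rewrite addn0 subrr expr0 subrr mulr0 /norm inner0l sqrtr0.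
have -> : u (p + m.+1)%N - u p = (u (p + m).+1 - u (p + m)%N) + (u (p + m)%N - u p).
  by rewrite addnS addrA subrK.
apply: le_trans (normD _ _) _; apply: le_trans (lerD (step _) IHm) _.
by rewrite le_eqVlt; apply/orP; left; apply/eqP; rewrite exprD exprS; field; exact: lt0r_neq0.
Qed.

Lemma descent_limit : exists l : H,
  (forall eps, 0 < eps -> exists N, forall p, (N <= p)%N -> norm (u p - l) < eps) /\
  norm (l - u 0%N) <= c / (1 - a).
Proof.
case/andP: (a01) => a0 a1; have a1' : 0 < 1 - a by rewrite subr_gt0.
have [|l lP] := @norm_complete H u.
  (* Dividing by [c + 1] covers the case [c = 0]. *)
  move=> eps eps0; have c1 : 0 < c + 1 by rewrite ltr_wpDl.
  have [|N NP] := @geometric_lt a (eps * (1 - a) / (c + 1)) a01.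
    by rewrite divr_gt0 // mulr_gt0.
  have bound p : (N <= p)%N -> c * a ^+ p / (1 - a) < eps.
    move=> /NP; rewrite ltr_pdivlMr // ltr_pdivrMr // => h.
    by apply: le_lt_trans h; rewrite mulrC ler_wpM2l ?exprn_ge0 // lerDl.
  exists N => p q Np Nq; have [pq|/ltnW qp] := leqP p q.
    rewrite -normN opprB -(subnKC pq).
    exact: le_lt_trans (tail_bound _ _) (bound _ Np).
  by rewrite -(subnKC qp); exact: le_lt_trans (tail_bound _ _) (bound _ Nq).
exists l; split=> //; rewrite leNgt; apply/negP => gap.
have [|N NP] := lP (norm (l - u 0%N) - c / (1 - a)); first by rewrite subr_gt0.
have := NP N (leqnn N); apply/negP; rewrite -leNgt lerBlDr.
have -> : l - u 0%N = - (u N - l) + (u N - u 0%N) by rewrite opprB addrA subrK.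
apply: le_trans (normD _ _) _; rewrite normN lerD2l.
by have := tail_bound 0 N; rewrite add0n expr0 mulr1.
Qed.

End Descent.

(** * The Laplacian in an orthogonal representation *)

Section SpecialLinear.
Variable n : nat.
Implicit Types g s : 'M[int]_n.

Lemma det_ginv g : \det g = 1 -> \det (ginv g) = 1.
Proof. by move=> dg; rewrite /ginv det_inv dg invr1. Qed.

Lemma det_Sgen s : s \in Sgen n -> \det s = 1.
Proof.
have dE (i j : 'I_n) : i != j -> \det (Elem i j) = 1.
  by move=> ij; rewrite -transvection1 det_transvection.
by case/mem_Sgen=> i [j [ij [] ->]]; rewrite ?det_ginv ?dE.
Qed.

Lemma det_inBall r g : inBall (Sgen n) r g -> \det g = 1.
Proof.
case=> w [_ [wS ->]]; elim: w wS => [|s w IHw] wS /=; first exact: det1.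
rewrite /gmul det_mulmx IHw ?mulr1; last by move=> t tw; apply: wS; rewrite inE tw orbT.
by apply: det_Sgen; apply: wS; exact: mem_head.
Qed.

Lemma big_Sgen (V : nmodType) (X : 'M[int]_n -> V) : \sum_(s <- Sgen n) X s =
  \sum_(e <- offdiag n) (X (Elem e.1 e.2) + X (ginv (Elem e.1 e.2))).
Proof. by rewrite big_cat !big_map big_split. Qed.

Lemma offdiagP e : e \in offdiag n -> e.1 != e.2.
Proof. by rewrite mem_filter => /andP[]. Qed.

End SpecialLinear.

Section Representation.
Variables (n : nat) (H : RHilbert) (pi : 'M[int]_n -> H -> H).
Hypothesis rep : orth_rep pi.
Implicit Types (v w : H) (g h : 'M[int]_n) (xi : RG n).

Lemma rep1 v : pi 1%:M v = v. Proof. by case: rep => + _; apply. Qed.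
Lemma repM g h v : \det g = 1 -> \det h = 1 -> pi (g *m h) v = pi g (pi h v).
Proof. by case: rep => _ [+ _] dg dh; apply. Qed.
Lemma rep_linear g a v w : \det g = 1 -> pi g (a *: v + w) = a *: pi g v + pi g w.
Proof. by case: rep => _ [_ [+ _]] dg; apply. Qed.
Lemma rep_inner g v w : \det g = 1 -> inner (pi g v) (pi g w) = inner v w.
Proof. by case: rep => _ [_ [_ +]] dg; apply. Qed.

Lemma rep0 g : \det g = 1 -> pi g 0 = 0.
Proof. by move=> dg; apply: inner_eq0; rewrite rep_inner // inner0l. Qed.
Lemma repZ g a v : \det g = 1 -> pi g (a *: v) = a *: pi g v.
Proof. by move=> dg; rewrite -[a *: v]addr0 rep_linear // rep0 // addr0. Qed.
Lemma repD g v w : \det g = 1 -> pi g (v + w) = pi g v + pi g w.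
Proof. by move=> dg; rewrite -[v]scale1r rep_linear // !scale1r. Qed.
Lemma repB g v w : \det g = 1 -> pi g (v - w) = pi g v - pi g w.
Proof. by move=> dg; rewrite repD // -scaleN1r repZ // scaleN1r. Qed.
Lemma norm_rep g v : \det g = 1 -> norm (pi g v) = norm v.
Proof. by move=> dg; rewrite /norm rep_inner. Qed.

Lemma rep_sum g (I : Type) (s : seq I) (X : I -> H) : \det g = 1 ->
  pi g (\sum_(i <- s) X i) = \sum_(i <- s) pi g (X i).
Proof.
by move=> dg; elim: s => [|i s IHs]; rewrite ?big_nil ?rep0 // !big_cons repD // IHs.
Qed.

Lemma rep_adjoint g v w : \det g = 1 -> inner (pi g v) w = inner v (pi (ginv g) w).
Proof.
move=> dg; have dgV := det_ginv dg; rewrite -[RHS](rep_inner _ _ dg) -repM //.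
by rewrite /ginv mulmxV ?rep1 // unitmxE dg unitr1.
Qed.

Definition act xi v : H := \sum_(p <- xi) p.2 *: pi p.1 v.
(** Taken as [F], it sends [xi^* xi] to the squared norm of [act xi v], so sums of squares take
    nonnegative values. *)
Definition matrix_coef v g : R := inner (pi g v) v.

Lemma eval_mul_act (x y : RG n) v : (forall p, p \in x -> \det p.1 = 1) ->
  (forall p, p \in y -> \det p.1 = 1) ->
  eval (matrix_coef v) (rg_mul x y) = inner (act x (act y v)) v.
Proof.
move=> xP yP; rewrite eval_mul /act inner_suml; apply: eq_big_seq => p /xP dp.
rewrite rep_sum // innerZl inner_suml big_distrr; apply: eq_big_seq => q /yP dq /=.
by rewrite repZ // innerZl mulrA /matrix_coef repM.
Qed.

Lemma square_act xi v : (forall p, p \in xi -> \det p.1 = 1) ->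
  square (matrix_coef v) xi = inner (act xi v) (act xi v).
Proof.
move=> xiP; rewrite squareE /act inner_suml; apply: eq_big_seq => p /xiP dp.
rewrite inner_sumr; apply: eq_big_seq => q /xiP dq.
rewrite innerZl innerZr mulrA; congr (_ * _).
by rewrite /matrix_coef repM ?det_ginv // innerC [RHS]rep_adjoint.
Qed.

Definition lap v : H := \sum_(s <- Sgen n) (v - pi s v).

Lemma act_laplacian v : act (laplacian (Sgen n)) v = lap v.
Proof.
rewrite /act /laplacian big_cons big_map /lap sumrB; congr (_ + _).
  by rewrite /= rep1 INRE big_const_seq count_predT iter_addr addr0 scaler_nat.
by rewrite -sumrN; apply: eq_bigr => s _; rewrite /= -[RHS]scaleN1r.
Qed.

Lemma lap_inner v w : inner (lap v) w = inner v (lap w).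
Proof.
rewrite /lap inner_suml inner_sumr.
under eq_bigr => s _ do rewrite innerDl innerNl.
under [RHS]eq_bigr => s _ do rewrite innerDr innerNr.
rewrite !sumrB; congr (_ - _); rewrite !big_Sgen; apply: eq_big_seq => e /offdiagP ij.
have dE := det_Sgen (Elem_Sgen ij); have dV := det_Sgen (ginv_Elem_Sgen ij).
by rewrite !rep_adjoint // (ginvK (Elem_mulV ij)) addrC.
Qed.

Lemma lap_linear a v w : lap (v - a *: w) = lap v - a *: lap w.
Proof.
rewrite /lap scaler_sumr -sumrB; apply: eq_big_seq => s /det_Sgen ds.
by rewrite repB // repZ // scalerBr !opprB addrACA [RHS]addrACA; congr (_ + _); rewrite addrC.
Qed.

Lemma energyE v : inner (lap v) v = 2^-1 * \sum_(s <- Sgen n) inner (pi s v - v) (pi s v - v).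
Proof.
rewrite /lap inner_suml big_distrr; apply: eq_big_seq => s /det_Sgen ds /=.
by rewrite !innerDl !innerDr !innerNl !innerNr rep_inner // (innerC v (pi s v)); field.
Qed.

Lemma energy_ge0 v : 0 <= inner (lap v) v.
Proof.
rewrite energyE mulr_ge0 ?invr_ge0 ?ler0n //.
by rewrite sumr_ge0 // => s _; exact: inner_ge0.
Qed.

Lemma energy_gen s v : s \in Sgen n -> inner (pi s v - v) (pi s v - v) <= 2 * inner (lap v) v.
Proof.
move=> sS; rewrite energyE mulVKf ?pnatr_eq0 // (big_rem s) //= lerDl.
by rewrite sumr_ge0 // => t _; exact: inner_ge0.
Qed.

Lemma energy_le v b : (forall s, s \in Sgen n -> inner (pi s v - v) (pi s v - v) <= b) ->
  inner (lap v) v <= 2^-1 * ((size (Sgen n))%:R * b).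
Proof.
move=> vb; rewrite energyE ler_wpM2l ?invr_ge0 ?ler0n //.
rewrite mulr_natl -(iter_addr_0 (size (Sgen n))) -(count_predT (Sgen n)) -big_const_seq.
by rewrite big_seq [leRHS]big_seq; exact: ler_sum.
Qed.

Lemma energy_bounded v : inner (lap v) v <= 2 * (size (Sgen n))%:R * inner v v.
Proof.
have -> : 2 * (size (Sgen n))%:R * inner v v =
    2^-1 * ((size (Sgen n))%:R * (4 * inner v v)) by field.
apply: energy_le => s /det_Sgen ds.
have := inner_ge0 (pi s v + v); rewrite !innerDl !innerDr !innerNl !innerNr rep_inner //.
by move=> h; lra.
Qed.

Lemma fixed_SL w : (forall s, s \in Sgen n -> pi s w = w) -> forall g, \det g = 1 -> pi g w = w.
Proof.
(* The determinant is part of the predicate because [pi] is assumed multiplicative only on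
   [SL_n(Z)]. *)
move=> Sw g dg; apply: (@SL_ind _ (fun A => \det A = 1 -> pi A w = w) _ _ _ g dg dg) => [_|A i j ij|A i j ij].
- exact: rep1.
- move=> IHA dA; have dE := det_Sgen (Elem_Sgen ij).
  by have := IHA; rewrite det_mulmx dA dE mulr1 repM // Sw ?Elem_Sgen //; apply.
- move=> IHA dA; have dE := det_Sgen (ginv_Elem_Sgen ij).
  by have := IHA; rewrite det_mulmx dA dE mulr1 repM // Sw ?ginv_Elem_Sgen //; apply.
Qed.

End Representation.

(** * Gradient descent to a fixed vector *)

Section PropertyT.
Variable n : nat.
Hypothesis n3 : (3 <= n)%N.

(** The step [t] is small enough for both [t * 2 |S| <= 1], where [2 |S|] bounds the Laplacian, and
    [t * lam < 1]. The energy shrinks by [1 - t * lam] per step, and distances by its square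
    root. *)
Definition descent_step : R := (2 * (size (Sgen n))%:R + spectral_gap n + 1)^-1.
Definition descent_rate : R := Num.sqrt (1 - descent_step * spectral_gap n).

Let lam := spectral_gap n.
Let t := descent_step.
Let a := descent_rate.

Let lam_gt0 : 0 < lam. Proof. exact: spectral_gap_gt0. Qed.

Let size_ge0 : 0 <= (size (Sgen n))%:R :> R. Proof. exact: ler0n. Qed.

Let t_inv_gt0 : 0 < 2 * (size (Sgen n))%:R + lam + 1.
Proof. by have := lam_gt0; have := size_ge0; lra. Qed.

Let t_gt0 : 0 < t. Proof. by rewrite /t /descent_step invr_gt0. Qed.

Let tlam : 0 < t * lam < 1.
Proof.
rewrite mulr_gt0 //= /t /descent_step mulrC ltr_pdivrMr // mul1r.
by have := size_ge0; rewrite -/lam; lra.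
Qed.

Let t_size : t * (2 * (size (Sgen n))%:R) <= 1.
Proof.
rewrite /t /descent_step mulrC ler_pdivrMr // mul1r.
by have := lam_gt0; rewrite -/lam; lra.
Qed.

Let sqr_a : a ^+ 2 = 1 - t * lam.
Proof. by rewrite sqr_sqrtr // subr_ge0 ltW //; case/andP: tlam. Qed.

Lemma descent_rate01 : 0 <= a < 1.
Proof.
rewrite sqrtr_ge0 -(ltr_sqr (sqrtr_ge0 _) ler01) /= -/a sqr_a expr1n gtrBl.
by case/andP: tlam.
Qed.

Section Rep.
Variables (H : RHilbert) (pi : 'M[int]_n -> H -> H).
Hypothesis rep : orth_rep pi.
Local Notation L := (lap pi).

(** [laplacian_sos] is evaluated at the matrix coefficient of [v], where each square becomes a
    squared norm. *)
Lemma gap_energy v : lam * inner (L v) v <= inner (L v) (L v).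
Proof.
have lapP p : p \in laplacian (Sgen n) -> \det p.1 = 1.
  rewrite inE => /orP[/eqP -> /=|/mapP[s /det_Sgen ds -> //]]; exact: det1.
have [xis [xisP /(_ (matrix_coef pi v)) E]] := laplacian_sos n.
have lapE : eval (matrix_coef pi v) (laplacian (Sgen n)) = inner (L v) v.
  rewrite -(act_laplacian rep) /act inner_suml; apply: eq_bigr => p _.
  by rewrite innerZl.
rewrite -(lap_inner rep) -subr_ge0 -lapE.
have <- : eval (matrix_coef pi v) (rg_mul (laplacian (Sgen n)) (laplacian (Sgen n))) =
    inner (L (L v)) v by rewrite (eval_mul_act rep) // !(act_laplacian rep).
rewrite E big_seq sumr_ge0 // => xi xi_in.
rewrite (square_act rep) ?inner_ge0 // => p p_in.
exact: det_inBall (xisP _ _ xi_in p_in).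
Qed.

Variable v : H.
Let u p : H := iter p (fun x => x - t *: L x) v.
Let energy p := inner (L (u p)) (u p).

(** The expansion has first-order term [-2 t |L x|^2]; since [t L <= 1], the second-order term is at
    most [t |L x|^2]. *)
Let energy_step p : energy p.+1 <= energy p - t * inner (L (u p)) (L (u p)).
Proof.
rewrite /energy [u p.+1]/(u p - t *: L (u p)); move: (u p) => x.
have bd := energy_bounded rep (L x).
have -> : inner (L (x - t *: L x)) (x - t *: L x) =
    inner (L x) x - 2 * t * inner (L x) (L x) + t ^+ 2 * inner (L (L x)) (L x).
  rewrite (lap_linear rep) !innerDl !innerDr !innerNl !innerNr !innerZl !innerZr.
  by rewrite (lap_inner rep (L x) x); ring.
have D0 := inner_ge0 (L x).
have : t ^+ 2 * inner (L (L x)) (L x) <= t * inner (L x) (L x).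
  rewrite expr2 -mulrA ler_pM2l //; apply: le_trans (ler_wpM2l (ltW t_gt0) bd) _.
  by rewrite mulrA -[leRHS]mul1r ler_wpM2r.
by move=> h; lra.
Qed.

Let grad_le p : t * inner (L (u p)) (L (u p)) <= energy p.
Proof. have := energy_step p; have := energy_ge0 rep (u p.+1); rewrite -/(energy _); lra. Qed.

Let energy_decay p : energy p <= energy 0 * (a ^+ p) ^+ 2.
Proof.
elim: p => [|p IHp]; first by rewrite expr0 expr1n mulr1.
have : energy p.+1 <= (1 - t * lam) * energy p.
  apply: le_trans (energy_step p) _; rewrite mulrBl mul1r lerD2l lerN2 -mulrA.
  by rewrite ler_pM2l // gap_energy.
move=> h; apply: le_trans h _; rewrite -sqr_a [a ^+ p.+1]exprS exprMn [leRHS]mulrCA.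
by rewrite ler_wpM2l ?sqr_ge0.
Qed.

Let energy0_ge0 : 0 <= energy 0. Proof. exact: energy_ge0. Qed.

Let a_ge0 : 0 <= a. Proof. by case/andP: descent_rate01. Qed.

Let step_le p : norm (u p.+1 - u p) <= Num.sqrt (t * energy 0) * a ^+ p.
Proof.
apply: norm_le; first by rewrite mulr_ge0 ?sqrtr_ge0 ?exprn_ge0.
rewrite [u p.+1]/(u p - t *: L (u p)) addrAC subrr add0r innerNl innerNr opprK.
rewrite innerZl innerZr exprMn sqr_sqrtr ?mulr_ge0 ?(ltW t_gt0) // -mulrA ler_pM2l //.
exact: le_trans (grad_le p) (energy_decay p).
Qed.

Let gen_le s p : s \in Sgen n -> norm (pi s (u p) - u p) <= Num.sqrt (2 * energy 0) * a ^+ p.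
Proof.
move=> sS; apply: norm_le; first by rewrite mulr_ge0 ?sqrtr_ge0 ?exprn_ge0.
rewrite exprMn sqr_sqrtr ?mulr_ge0 ?ler0n //; apply: le_trans (energy_gen rep _ sS) _.
by rewrite -mulrA ler_pM2l ?ltr0n //; exact: energy_decay.
Qed.

Lemma nearby_fixed_vector : exists l : H, (forall s, s \in Sgen n -> pi s l = l) /\
  norm (l - v) <= Num.sqrt (t * inner (L v) v) / (1 - a).
Proof.
have [l [lP l_near]] := descent_limit descent_rate01 step_le.
exists l; split=> // s sS; have ds := det_Sgen sS.
apply/eqP; rewrite -subr_eq0; apply/eqP; apply: contrapT => /norm_gt0 d_gt0.
set d := norm _ in d_gt0; set c := Num.sqrt (2 * energy 0).
have c1 : 0 < c + 1 by rewrite ltr_wpDl ?sqrtr_ge0.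
(* The distance [d] from [l] to [pi s l] is at most twice that from [u p] to [l] plus that from
   [u p] to [pi s (u p)]. The thresholds [d / 4] and [d / 2] then give [d < d]. *)
have [|N1 N1P] := lP (d / 4); first by rewrite divr_gt0 ?ltr0n.
have [|N2 N2P] := @geometric_lt a (d / 2 / (c + 1)) descent_rate01.
  by rewrite !divr_gt0 ?ltr0n.
pose p := maxn N1 N2; have near := N1P p (leq_maxl _ _).
have small : norm (pi s (u p) - u p) < d / 2.
  apply: le_lt_trans (gen_le p sS) _; have := N2P p (leq_maxr _ _).
  rewrite ltr_pdivlMr // => h; apply: le_lt_trans h; rewrite mulrC ler_wpM2l ?exprn_ge0 //.
  by rewrite lerDl.
suff : d < d by rewrite ltxx.
have dE : d = norm (- pi s (u p - l) + (pi s (u p) - u p + (u p - l))).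
  by rewrite (repB rep) // opprB !addrA !subrK.
rewrite {1}dE; apply: le_lt_trans (normD _ _) _.
have := normD (pi s (u p) - u p) (u p - l); rewrite normN (norm_rep rep) //.
by move: small near => /[swap]; rewrite -/p; lra.
Qed.

End Rep.

Theorem property_T : PropertyT_SL n.
Proof.
exists (Sgen n); split; first exact: det_Sgen.
have /andP[a_ge0 a_lt1] := descent_rate01; have a_pos : 0 < 1 - a by rewrite subr_gt0.
(* With this constant the fixed vector lies within [norm v / 2] of [v], hence is nonzero. *)
exists ((1 - a) / 2); split; first by apply/RltP; rewrite divr_gt0 ?ltr0n.
move=> H pi rep [v [v0 v_almost]].
have [l [l_fixed l_near]] := nearby_fixed_vector rep v.
exists l; split=> [l0|g dg]; last exact: (fixed_SL rep l_fixed dg).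
have nv := norm_gt0 v0; move: l_near; rewrite l0 sub0r normN; apply/negP; rewrite -ltNge.
rewrite ltr_pdivrMr //.
suff h : Num.sqrt (t * inner (lap pi v) v) <= (1 - a) / 2 * norm v.
  by apply: le_lt_trans h _; rewrite mulrC ltr_pM2l //; lra.
have rhs_ge0 : 0 <= (1 - a) / 2 * norm v by rewrite mulr_ge0 ?norm_ge0 // divr_ge0 // ltW.
rewrite -(ger0_norm rhs_ge0) -sqrtr_sqr ler_wsqrtr //.
set b := _ ^+ 2; have b_ge0 : 0 <= b by exact: sqr_ge0.
have : inner (lap pi v) v <= 2^-1 * ((size (Sgen n))%:R * b).
  apply: (energy_le rep) => s sS; rewrite -sqr_norm /b ler_sqr ?nnegrE ?norm_ge0 //.
  by apply: ltW; rewrite -!hnormE; apply/RltP; exact: v_almost.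
move=> /(ler_wpM2l (ltW t_gt0)) h; apply: le_trans h _.
have -> : t * (2^-1 * ((size (Sgen n))%:R * b)) = t * (2 * (size (Sgen n))%:R) * (b / 4) by field.
apply: le_trans (ler_wpM2r _ t_size) _; first by rewrite divr_ge0 ?ler0n.
by lra.
Qed.

End PropertyT.

Theorem theorem5p3 (n : nat) (hn : (3 <= n)%N) :
  PropertyT_SL n /\ KazhdanRadiusLe (Sgen n) 2.
Proof. by split; [exact: property_T|exact: kazhdan_radius]. Qed.
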